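(* Let $G$ be a strongly connected directed graph on $N$ nodes with gossip matrix $W_0$, and let $W$ be either $W_0$ itself (no delays, $N_v=N$) or an extension of $W_0$ with delays, of size $N_v\times N_v$. Let $W^\infty=\lim_{t\to\infty}W^t$, let $(\pi_1,\dots,\pi_{N_v})$ be the common row of $W^\infty$, and let $C$ and $\rho<1$ be constants with $\|W^t-W^\infty\|_2^2\le C\rho^t$ for all integers $t>0$. Let $T$ be a number of iterations, and let $\tau_g$ be a number of gossip rounds large enough that $\|W^{\tau_g}-W^\infty\|_2^2\le C\rho^{\tau_g}=:1-c<1$. Suppose that each $f_n:\mathbb{R}^d\to\mathbb{R}$, $n=1,\dots,N$, is $L$-smooth, and that the nodes have access to unbiased stochastic gradients $\nabla F_n(x,\xi_n)$ satisfying, for all $x\in\mathbb{R}^d$ and $n=1,\dots,N$, $$\mathbb{E}\|\nabla F_n(x,\xi_n)-\nabla f_n(x)\|^2\le\sigma_n^2,\qquad \mathbb{E}\|\nabla F_n(x,\xi_n)\|^2\le G^2 .$$ Put $f=\frac1N\sum_{n=1}^N f_n$ and $\overline\sigma^2=\frac1N\sum_{n=1}^N\sigma_n^2$, and let $f^\star$ be a lower bound for $f$. Then there exists a constant stepsize $\eta$ (depending on $T$) such that the DT-GO iterations with stepsize $\eta$, with $\tilde x(t)=\sum_{n=1}^{N_v}\pi_n x_n(t)$, satisfy $$\frac1T\sum_{t=0}^{T-1}\mathbb{E}\|\nabla f(\tilde x(t))\|_2^2=\mathcal{O}\left(\left(\frac{LF_0\overline\sigma^2}{NT}\right)^{1/2}+\left(\frac{\|D\|_2\,G\,L\,F_0}{cT}\right)^{2/3}+\frac{LF_0}{T}\right),$$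 where $F_0=f(\tilde x(0))-f^\star$, $D$ is the diagonal correction matrix, and $\mathcal{O}$ hides an absolute constant.
   Context: Gossip matrix: for a strongly connected directed graph $G$ on nodes $1,\dots,N$, with a self-loop at every node, a gossip matrix $W$ is a real $N\times N$ matrix such that (i) every row sums to $1$; (ii) $W_{nm}\ge0$, and $W_{nm}=0$ if and only if there is no directed edge from node $m$ to node $n$; (iii) all diagonal entries are positive. Extension with delays: each edge $m\to n$ of $G$ with $m\ne n$ is assigned an integer delay $k\ge0$ (self-loops are not delayed). Every edge $m\to n$ with delay $k\ge1$ is removed and replaced by a directed path $m\to v_1\to\dots\to v_k\to n$ through $k$ new virtual nodes (used by this edge only, without self-loops); the edge $v_k\to n$ receives weight $W_{nm}$, and the edges $m\to v_1$, $v_1\to v_2$, ..., $v_{k-1}\to v_k$ receive weight $1$. All other weights are unchanged. The resulting $N_v\times N_v$ row-stochastic matrix is the extended matrix; the original nodes, numbered $1,\dots,N$, are called non-virtual, and nodes $N+1,\dots,N_v$ are virtual. For $W$ a gossip matrix or its extension, $W^\infty=\lim_t W^t$ exists, has all rows identical, and has $\pi_n>0$ for $n\le N$; constants $C,\rho$ as in the claim exist. Correction matrix: $D$ is the $N_v\times N_v$ diagonal matrix with $D_{nn}=\frac{1}{N\pi_n}$ for non-virtual nodes $n\le N$ and $D_{nn}=1$ for virtual nodes. $\|\cdot\|_2$ of a matrix is the spectral norm. DT-GO iterations (with the weights $\pi_n$ known exactly): each node $n$ has an initial state $x_n(0)\in\mathbb{R}^d$. $X(t)$ is the $N_v\times d$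 matrix whose rows are the node states $x_1(t),\dots,x_{N_v}(t)$, and $$X(t+1)=W^{\tau_g}\bigl(X(t)-\eta D\,\partial F(t)\bigr),\quad t\ge0,$$ where $\partial F(t)$ is the $N_v\times d$ matrix of stochastic gradients at time $t$: its $n$-th row is $\nabla F_n(x_n(t),\xi_n)$ for $n\le N$, with $\xi_n$ the random sample used by node $n$ at iteration $t$, and $0$ for virtual nodes (whose objective function is $0$). $L$-smooth means $\|\nabla f_n(y)-\nabla f_n(x)\|\le L\|y-x\|$ for all $x,y\in\mathbb{R}^d$. Unbiased means $\mathbb{E}[\nabla F_n(x,\xi_n)]=\nabla f_n(x)$ for all $x\in\mathbb{R}^d$.
   Formalization: The samples are assumed mutually independent over all nodes and iterations; the bound is proved for every T when all initial states are equal, and for arbitrary initial states only for T at least some T_0 depending on the instance, since it fails uniformly in T otherwise. *)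

(* Defs.v *)
From mathcomp Require Import all_boot all_order all_algebra.
From mathcomp Require Import all_classical all_reals all_analysis.

Set Implicit Arguments.
Unset Strict Implicit.
Unset Printing Implicit Defensive.

Import Order.TTheory GRing.Theory Num.Theory.
Import numFieldNormedType.Exports.

Local Open Scope classical_set_scope.
Local Open Scope ring_scope.

Section Norms.
Variable R : realType.

(* The library norm on matrices is the sup norm; on row and column vectors the
   following one is the Euclidean norm. *)
Definition l2norm (m n : nat) (A : 'M[R]_(m, n)) : R :=
  Num.sqrt (\sum_i \sum_j A i j ^+ 2).

(* Spectral norm: the operator norm induced by the Euclidean norm. *)
Definition specnorm (m n : nat) (A : 'M[R]_(m, n)) : R :=
  sup [set l2norm (A *m x) | x in [set x : 'cV[R]_n | l2norm x <= 1]].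

Definition grad (d : nat) (f : 'rV[R]_d -> R) (x : 'rV[R]_d) : 'rV[R]_d :=
  \row_j 'D_(delta_mx 0 j) f x.

Definition smooth (d : nat) (L : R) (f : 'rV[R]_d -> R) : Prop :=
  (forall x, differentiable f x) /\
  (forall x y, l2norm (grad f y - grad f x) <= L * l2norm (y - x)).

End Norms.

Section Graphs.
Variables (R : realType) (N : nat).

(* [e m n] means that there is an edge from [m] to [n]. *)
Definition gossip_graph (e : rel 'I_N) : Prop :=
  (forall n, e n n) /\ (forall m n, connect e m n).

(* The entry [W n m] is the weight of the edge from [m] to [n]. *)
Definition gossip_matrix (e : rel 'I_N) (W : 'M[R]_N) : Prop :=
  [/\ forall n, \sum_m W n m = 1,
      forall n m, 0 <= W n m,
      forall n m, W n m = 0 <-> ~~ e m n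
    & forall n, 0 < W n n].

Variables (e : rel 'I_N) (k : 'I_N -> 'I_N -> nat).

(* [k] is only meaningful on the edges between distinct nodes. *)
Definition edge_delay (mn : 'I_N * 'I_N) : nat :=
  if e mn.1 mn.2 && (mn.1 != mn.2) then k mn.1 mn.2 else 0%N.

(* The virtual node [existT _ (m, n) j] is the node v_(j+1) of the path that
   replaces the edge m -> n. *)
Definition vnode : Type := {mn : 'I_N * 'I_N & 'I_(edge_delay mn)}.

Definition ext_size : nat := (N + #|{: vnode}|)%N.

(* The non-virtual nodes come first in the numbering. *)
Definition node_of (i : 'I_ext_size) : 'I_N + vnode :=
  match fintype.split i with
  | inl n => inl n
  | inr v => inr (enum_val v)
  end.

Variable W : 'M[R]_N.

(* [ext_weight a b] is the weight of the edge from [b] to [a]. *)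
Definition ext_weight (a b : 'I_N + vnode) : R :=
  match a, b with
  | inl n, inl m => if edge_delay (m, n) == 0%N then W n m else 0
  | inl n, inr v =>
      if ((tag v).2 == n) && ((tagged v).+1 == edge_delay (tag v))
      then W n (tag v).1 else 0
  | inr u, inl m => ((tag u).1 == m)%:R * (tagged u == 0%N :> nat)%:R
  | inr u, inr v =>
      (tag u == tag v)%:R * (tagged u == (tagged v).+1 :> nat)%:R
  end.

Definition ext_matrix : 'M[R]_ext_size :=
  \matrix_(i, j) ext_weight (node_of i) (node_of j).

(* With all delays equal to 0 there is no virtual node and the extended matrix
   is [W] itself. *)
Lemma ext_size0 : (forall m n, k m n = 0%N) -> ext_size = N.
Proof.
move=> k0; rewrite /ext_size; apply/eqP; rewrite -[X in _ == X]addn0 eqn_add2l.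
apply/eqP/eq_card0 => -[mn j]; exfalso; case: j => j.
by rewrite /edge_delay k0 if_same.
Qed.

Lemma ext_matrix0 : (forall m n, k m n = 0%N) ->
  forall n m : 'I_N, ext_matrix (lshift _ n) (lshift _ m) = W n m.
Proof.
move=> k0 n m; rewrite mxE /node_of.
by rewrite !(unsplitK (inl _)) /= /edge_delay k0 if_same eqxx.
Qed.

(* [pi] is the common row of the limit of the powers of the weight matrix. *)
Definition correction (pi : 'rV[R]_ext_size) : 'M[R]_ext_size :=
  diag_mx (\row_i match node_of i with
                  | inl _ => (N%:R * pi 0 i)^-1
                  | inr _ => 1
                  end).

Section Iterations.
Variables (d : nat) (dS : measure_display) (S : 'I_N -> measurableType dS).
Variable gF : forall n, 'rV[R]_d -> S n -> 'rV[R]_d.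

Definition stoch_grads (X : 'M[R]_(ext_size, d)) (z : forall n, S n) :
    'M[R]_(ext_size, d) :=
  \matrix_i match node_of i with
            | inl n => gF (row i X) (z n)
            | inr _ => 0
            end.

Fixpoint dtgo (Wg D : 'M[R]_ext_size) (tau : nat) (eta : R)
    (X0 : 'M[R]_(ext_size, d)) (z : nat -> forall n, S n) (t : nat) :
    'M[R]_(ext_size, d) :=
  match t with
  | 0%N => X0
  | t'.+1 =>
      let X := dtgo Wg D tau eta X0 z t' in
      (Wg ^+ tau) *m (X - eta *: (D *m stoch_grads X (z t')))
  end.

End Iterations.

Definition weighted_avg (d : nat) (pi : 'rV[R]_ext_size)
    (X : 'M[R]_(ext_size, d)) : 'rV[R]_d :=
  \sum_i pi 0 i *: row i X.

End Graphs.

Definition mutually_independent (R : realType) (dO dS : measure_display)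
    (Omega : measurableType dO) (P : probability Omega R) (I : choiceType)
    (S : I -> measurableType dS) (X : forall i, Omega -> S i) : Prop :=
  (forall i, measurable_fun [set: Omega] (X i)) /\
  (forall (s : seq I) (A : forall i, set (S i)),
     uniq s -> (forall i, measurable (A i)) ->
     P (\bigcap_(i in [set` s]) (X i @^-1` A i)) =
     (\prod_(i <- s) P (X i @^-1` A i))%E).

(* [d.-tuple R] carries the Borel sigma-algebra of R^d; ['rV[R]_d] has no
   measurable structure in the library. *)
Definition jointly_measurable (R : realType) (d : nat) (dS : measure_display)
    (S : measurableType dS) (g : 'rV[R]_d -> S -> 'rV[R]_d) : Prop :=
  forall j, measurable_fun [set: d.-tuple R * S]
    (fun p => g (\row_i tnth p.1 i) p.2 0 j).

(* Main.v *)
Require Import Defs.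
From HB Require Import structures.
From mathcomp Require Import all_boot all_order all_algebra.
From mathcomp Require Import all_classical all_reals all_analysis.
From mathcomp Require Import measurable_realfun ring lra.

Set Implicit Arguments.
Unset Strict Implicit.
Unset Printing Implicit Defensive.

Import Order.TTheory GRing.Theory Num.Theory.
Import numFieldNormedType.Exports.

Local Open Scope classical_set_scope.
Local Open Scope ring_scope.

(* Let [x t] be the [pi]-weighted average of the iterates. Since [pi W = pi] and [D]
   cancels the weights, [x t.+1 = x t - eta * gbar t] with [gbar] the plain mean of the
   stochastic gradients. The consensus error is measured by [X - Winf X]; because
   [(W^tau - Winf) Winf = 0], one round contracts its squared norm by [1 - c / 2], up to
   [(2 / c) eta^2 |D|^2] times the squared norm of the gradients. The descent lemma for
   the averaged objective, with a multiple of the consensus error added as Lyapunov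
   function, gives an inequality that holds for every realisation of the samples; summing
   it over [t] telescopes, and only then are expectations taken. This needs that the mean
   noise [gbar - h] is orthogonal to functions of the past and that the noises of distinct
   nodes are uncorrelated, both by Fubini's theorem, a sample being independent of the
   sigma-algebra generated by all the other ones. The stepsize balances the remaining
   terms; [T0] is taken so large that the initial disagreement is absorbed. When [F0],
   [L] or [G] vanishes, so do the gradients along the trajectory (for [F0 = 0] with
   [eta = 0], as [x 0] is a minimiser). *)

(** * Frobenius and spectral norms *)

Section Frobenius.
Context {R : realType}.

Definition mxdot m n (A B : 'M[R]_(m, n)) : R := \sum_i \sum_j A i j * B i j.

Section MxdotTheory.
Variables m n : nat.
Implicit Types A B C : 'M[R]_(m, n).

Lemma mxdotC A B : mxdot A B = mxdot B A.
Proof. by apply: eq_bigr => i _; apply: eq_bigr => j _; rewrite mulrC. Qed.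

Lemma mxdotDl A B C : mxdot (A + B) C = mxdot A C + mxdot B C.
Proof.
rewrite -big_split; apply: eq_bigr => i _; rewrite -big_split.
by apply: eq_bigr => j _; rewrite mxE mulrDl.
Qed.

Lemma mxdotZl a A B : mxdot (a *: A) B = a * mxdot A B.
Proof.
rewrite mulr_sumr; apply: eq_bigr => i _; rewrite mulr_sumr.
by apply: eq_bigr => j _; rewrite mxE mulrA.
Qed.

Lemma mxdotNl A B : mxdot (- A) B = - mxdot A B.
Proof. by rewrite -scaleN1r mxdotZl mulN1r. Qed.

Lemma mxdotBl A B C : mxdot (A - B) C = mxdot A C - mxdot B C.
Proof. by rewrite mxdotDl mxdotNl. Qed.

Lemma mxdotDr A B C : mxdot A (B + C) = mxdot A B + mxdot A C.
Proof. by rewrite mxdotC mxdotDl !(mxdotC A). Qed.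

Lemma mxdotZr a A B : mxdot A (a *: B) = a * mxdot A B.
Proof. by rewrite mxdotC mxdotZl mxdotC. Qed.

Lemma mxdotNr A B : mxdot A (- B) = - mxdot A B.
Proof. by rewrite mxdotC mxdotNl mxdotC. Qed.

Lemma mxdotBr A B C : mxdot A (B - C) = mxdot A B - mxdot A C.
Proof. by rewrite mxdotDr mxdotNr. Qed.

Lemma mxdot_suml (I : Type) (r : seq I) (F : I -> 'M[R]_(m, n)) A :
  mxdot (\sum_(i <- r) F i) A = \sum_(i <- r) mxdot (F i) A.
Proof.
rewrite (big_morph (fun B => mxdot B A) (id1 := 0) (op1 := +%R)) // => [B C|]; first exact: mxdotDl.
by rewrite -(scale0r 0) mxdotZl mul0r.
Qed.

Lemma mxdot_sumr (I : Type) (r : seq I) (F : I -> 'M[R]_(m, n)) A :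
  mxdot A (\sum_(i <- r) F i) = \sum_(i <- r) mxdot A (F i).
Proof. by rewrite mxdotC mxdot_suml; apply: eq_bigr => i _; rewrite mxdotC. Qed.

Lemma mxdot_ge0 A : 0 <= mxdot A A.
Proof. by do 2!(apply: sumr_ge0 => ? _); rewrite -expr2 sqr_ge0. Qed.

Lemma l2norm_ge0 A : 0 <= l2norm A.
Proof. exact: sqrtr_ge0. Qed.

Lemma l2norm_sqr A : l2norm A ^+ 2 = mxdot A A.
Proof.
rewrite /l2norm sqr_sqrtr.
  by apply: eq_bigr => i _; apply: eq_bigr => j _; rewrite expr2.
by do 2!(apply: sumr_ge0 => ? _); rewrite sqr_ge0.
Qed.

Lemma l2norm_eq0 A : (l2norm A == 0) = (A == 0).
Proof.
apply/eqP/eqP => [|->]; last first.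
  by apply/eqP; rewrite -sqrf_eq0 l2norm_sqr -(scale0r 0) mxdotZl mul0r.
move=> A0; apply/matrixP => i j; rewrite mxE.
have : mxdot A A == 0 by rewrite -l2norm_sqr A0 expr0n.
rewrite psumr_eq0 => [/allP/(_ i)|k _]; last first.
  by apply: sumr_ge0 => ? _; rewrite -expr2 sqr_ge0.
rewrite mem_index_enum => /(_ isT) /=.
rewrite psumr_eq0 => [/allP/(_ j)|k _]; last by rewrite -expr2 sqr_ge0.
by rewrite mem_index_enum => /(_ isT) /=; rewrite mulf_eq0 orbb => /eqP.
Qed.

Lemma l2norm0 : l2norm (0 : 'M[R]_(m, n)) = 0.
Proof. by apply/eqP; rewrite l2norm_eq0. Qed.

Lemma l2normZ a A : l2norm (a *: A) = `|a| * l2norm A.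
Proof.
apply/eqP; rewrite -(@eqrXn2 _ 2) ?mulr_ge0 ?l2norm_ge0//.
by rewrite exprMn !l2norm_sqr mxdotZl mxdotZr mulrA -expr2 real_normK// num_real.
Qed.

Lemma l2normN A : l2norm (- A) = l2norm A.
Proof. by rewrite -scaleN1r l2normZ normrN1 mul1r. Qed.

(** Expand the nonnegative square of [a *: A - B] and divide by [a]. The weight [a] stays free
    because the contraction estimate and Cauchy-Schwarz need different choices of it. *)
Lemma mxdot_amgm (a : R) A B : 0 < a ->
  2 * mxdot A B <= a * l2norm A ^+ 2 + a^-1 * l2norm B ^+ 2.
Proof.
move=> a0; have := mxdot_ge0 (a *: A - B).
rewrite !l2norm_sqr mxdotBl !mxdotBr !mxdotZl !mxdotZr (mxdotC B A) => h.
rewrite -(ler_pM2l a0); have -> : a * (a * mxdot A A + a^-1 * mxdot B B) =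
  a * (a * mxdot A A) + mxdot B B by rewrite mulrDr (mulrA a a^-1) divff ?gt_eqF// mul1r.
lra.
Qed.

Lemma l2normB_sqr_le (a : R) A B : 0 < a ->
  l2norm (A - B) ^+ 2 <= (1 + a) * l2norm A ^+ 2 + (1 + a^-1) * l2norm B ^+ 2.
Proof.
move=> a0; have := @mxdot_amgm a A (- B) a0; rewrite l2normN mxdotNr.
rewrite (l2norm_sqr (A - B)) mxdotBl !mxdotBr (mxdotC B A) -!l2norm_sqr; lra.
Qed.

Lemma mxdot_young A B : mxdot A B <= (l2norm A ^+ 2 + l2norm B ^+ 2) / 2.
Proof. by have := @mxdot_amgm 1 A B ltr01; rewrite invr1 !mul1r; lra. Qed.

Lemma mxdot_CS A B : mxdot A B <= l2norm A * l2norm B.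
Proof.
have [/eqP|A0] := eqVneq (l2norm A) 0.
  by rewrite l2norm_eq0 => /eqP->; rewrite l2norm0 mul0r -(scale0r 0) mxdotZl mul0r.
have [/eqP|B0] := eqVneq (l2norm B) 0.
  by rewrite l2norm_eq0 => /eqP->; rewrite l2norm0 mulr0 -(scale0r 0) mxdotZr mul0r.
have pA : 0 < l2norm A by rewrite lt0r A0 l2norm_ge0.
have pB : 0 < l2norm B by rewrite lt0r B0 l2norm_ge0.
(* With this weight both terms on the right equal [l2norm A * l2norm B]. *)
have := @mxdot_amgm (l2norm B / l2norm A) A B (divr_gt0 pB pA).
have -> : l2norm B / l2norm A * l2norm A ^+ 2 + (l2norm B / l2norm A)^-1 * l2norm B ^+ 2 =
  2 * (l2norm A * l2norm B) by field; rewrite A0 B0.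
lra.
Qed.

Lemma l2normD_sqr A B : l2norm (A + B) ^+ 2 <= 2 * (l2norm A ^+ 2 + l2norm B ^+ 2).
Proof.
rewrite l2norm_sqr mxdotDl !mxdotDr (mxdotC B A) -!l2norm_sqr.
have := mxdot_young A B; lra.
Qed.

End MxdotTheory.

Lemma l2norm_sqr_row m n (A : 'M[R]_(m, n)) : l2norm A ^+ 2 = \sum_i l2norm (row i A) ^+ 2.
Proof.
rewrite l2norm_sqr; apply: eq_bigr => i _.
by rewrite l2norm_sqr /mxdot big_ord1; apply: eq_bigr => j _; rewrite !mxE.
Qed.

Lemma l2norm_sqr_col m n (A : 'M[R]_(m, n)) : l2norm A ^+ 2 = \sum_j l2norm (col j A) ^+ 2.
Proof.
rewrite l2norm_sqr /mxdot exchange_big; apply: eq_bigr => j _.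
by rewrite l2norm_sqr; apply: eq_bigr => i _; rewrite big_ord1 !mxE.
Qed.

(** The square expands into inner products over all pairs of indices, and Young's inequality bounds
    each of them by the mean of two squares. *)
Lemma l2norm_sqr_sum m n (I : finType) (F : I -> 'M[R]_(m, n)) :
  l2norm (\sum_i F i) ^+ 2 <= #|I|%:R * \sum_i l2norm (F i) ^+ 2.
Proof.
rewrite l2norm_sqr mxdot_suml.
apply: (@le_trans _ _ (\sum_i \sum_j (l2norm (F i) ^+ 2 + l2norm (F j) ^+ 2) / 2)).
  by apply: ler_sum => i _; rewrite mxdot_sumr; apply: ler_sum => j _; exact: mxdot_young.
under eq_bigr do rewrite -mulr_suml big_split/= sumr_const.
rewrite -mulr_suml big_split /= sumr_const sumrMnl -[X in _ *+ X]/#|I|.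
by rewrite -mulr_natl; lra.
Qed.

Lemma l2norm_mul m n p (A : 'M[R]_(m, n)) (B : 'M[R]_(n, p)) :
  l2norm (A *m B) ^+ 2 <= l2norm A ^+ 2 * l2norm B ^+ 2.
Proof.
rewrite (l2norm_sqr_row A) l2norm_sqr_col (l2norm_sqr_col B) mulr_sumr.
apply: ler_sum => j _; rewrite mulr_suml l2norm_sqr.
apply: ler_sum => i _; rewrite big_ord1 !mxE -expr2.
have -> : \sum_k A i k * B k j = mxdot (row i A) (col j B)^T.
  by rewrite /mxdot big_ord1; apply: eq_bigr => k _; rewrite !mxE.
have -> : l2norm (col j B) = l2norm (col j B)^T.
  rewrite /l2norm exchange_big; congr (Num.sqrt _).
  by apply: eq_bigr => a _; apply: eq_bigr => b _; rewrite !mxE.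
rewrite -exprMn; set x := mxdot _ _; set y := _ * _.
have xy : x <= y by exact: mxdot_CS.
have yx : - x <= y.
  by rewrite /x -mxdotNl (le_trans (mxdot_CS _ _))// l2normN.
have : 0 <= (y - x) * (y - - x) by rewrite mulr_ge0 ?subr_ge0.
rewrite expr2 expr2; lra.
Qed.

(** [sup] has its intended meaning only on a nonempty set that is bounded above; the Frobenius norm
    of [A] is an upper bound by [l2norm_mul]. *)
Lemma specnorm_has_sup m n (A : 'M[R]_(m, n)) :
  has_sup [set l2norm (A *m x) | x in [set x : 'cV[R]_n | l2norm x <= 1]].
Proof.
split; first by exists (l2norm (A *m (0 : 'cV_n))); exists 0 => //=; rewrite l2norm0.
exists (l2norm A) => _ [x x1 <-].
rewrite -(@ler_pXn2r _ 2%N) ?nnegrE ?l2norm_ge0// (le_trans (l2norm_mul _ _))//.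
by rewrite ler_piMr ?sqr_ge0// exprn_ile1 ?l2norm_ge0.
Qed.

Lemma specnorm_ge0 m n (A : 'M[R]_(m, n)) : 0 <= specnorm A.
Proof.
apply: (@le_trans _ _ (l2norm (A *m (0 : 'cV_n)))); first exact: l2norm_ge0.
apply: ub_le_sup; first by case: (specnorm_has_sup A).
by exists 0 => //=; rewrite l2norm0.
Qed.

Lemma specnorm_mulcV m n (A : 'M[R]_(m, n)) (x : 'cV[R]_n) :
  l2norm (A *m x) <= specnorm A * l2norm x.
Proof.
have [/eqP|x0] := eqVneq (l2norm x) 0.
  by rewrite l2norm_eq0 => /eqP->; rewrite mulmx0 !l2norm0 mulr0.
have px : 0 < l2norm x by rewrite lt0r x0 l2norm_ge0.
have -> : A *m x = l2norm x *: (A *m ((l2norm x)^-1 *: x)).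
  by rewrite -scalemxAr scalerA divff// scale1r.
rewrite l2normZ gtr0_norm// mulrC ler_pM2r//.
apply: ub_le_sup; first by case: (specnorm_has_sup A).
by exists ((l2norm x)^-1 *: x) => //=; rewrite l2normZ gtr0_norm ?invr_gt0// mulVf.
Qed.

(** The vector inequality is applied to each column. The states form a matrix with [d] columns, so
    the spectral norm of the weights has to be paired with a Frobenius norm. *)
Lemma specnorm_mul m n p (A : 'M[R]_(m, n)) (X : 'M[R]_(n, p)) :
  l2norm (A *m X) ^+ 2 <= specnorm A ^+ 2 * l2norm X ^+ 2.
Proof.
rewrite l2norm_sqr_col (l2norm_sqr_col X) mulr_sumr; apply: ler_sum => j _.
have -> : col j (A *m X) = A *m col j X by apply/matrixP=> a b; rewrite !mxE; apply: eq_bigr => k _; rewrite !mxE.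
rewrite -exprMn lerXn2r ?nnegrE ?mulr_ge0 ?specnorm_ge0 ?l2norm_ge0//.
exact: specnorm_mulcV.
Qed.

End Frobenius.

(** * Independence and Fubini *)

Section SigmaOthers.
Context (R : realType) (dO dS : measure_display) (Omega : measurableType dO)
  (P : probability Omega R) (I : choiceType) (S : I -> measurableType dS)
  (X : forall i, Omega -> S i).
Variable i0 : I.

(* An intersection-stable family generating the sigma-algebra of all the variables but
   [X i0]. *)
Definition cylinders_off : set (set Omega) :=
  [set A | exists s (B : forall i, set (S i)),
     [/\ uniq s, i0 \notin s, forall i, measurable (B i)
       & A = \bigcap_(i in [set` s]) X i @^-1` B i]].

Hypothesis indep : mutually_independent P X.

Let mX i : measurable_fun [set: Omega] (X i). Proof. exact: indep.1. Qed.

Let measurable_preX i (B : set (S i)) : measurable B -> measurable (X i @^-1` B).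
Proof. by move=> mB; rewrite -[X in measurable X]setTI; exact: mX. Qed.

Lemma cylinders_off_measurable : cylinders_off `<=` measurable.
Proof.
move=> _ [s [B [us _ mB ->]]].
apply: fin_bigcap_measurable => // i _; exact: measurable_preX.
Qed.

Lemma cylinders_offI : setI_closed cylinders_off.
Proof.
move=> _ _ [s1 [B1 [us1 i1 mB1 ->]]] [s2 [B2 [us2 i2 mB2 ->]]].
pose B i := (if i \in s1 then B1 i else setT) `&` (if i \in s2 then B2 i else setT).
exists (undup (s1 ++ s2)), B; split.
- exact: undup_uniq.
- by rewrite mem_undup mem_cat negb_or i1.
- by move=> i; apply: measurableI; case: ifP.
- apply/seteqP; split=> w /=.
    move=> [w1 w2] i /=; rewrite mem_undup mem_cat => _; rewrite /B /=.
    by split; case: ifP => // is_; [apply: w1|apply: w2].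
  move=> wB; split=> i /= is_; have := wB i.
    by rewrite /= mem_undup mem_cat is_ => /(_ isT); rewrite /B/= is_ => -[].
  by rewrite /= mem_undup mem_cat is_ orbT => /(_ isT); rewrite /B/= is_ => -[].
Qed.

(** A pi-lambda argument: for fixed [B] both sides are finite measures in [A], and they agree on the
    intersection-stable family of cylinders by mutual independence. *)
Lemma sigma_off_indep (A : set Omega) (B : set (S i0)) :
  <<s cylinders_off >> A -> measurable B ->
  (P (A `&` X i0 @^-1` B) = P A * P (X i0 @^-1` B))%E.
Proof.
move=> GA mB; have mXB := measurable_preX mB.
pose r : {nonneg R} := NngNum (fine_ge0 (measure_ge0 P (X i0 @^-1` B))).
have rE : (r%:num)%:E = P (X i0 @^-1` B) by rewrite /= fineK ?fin_num_measure.
suff : mrestr P mXB A = mscale r P A by rewrite /mrestr /mscale rE muleC.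
apply: (@g_sigma_algebra_measure_unique _ _ _ _ cylinders_off_measurable
  (fun=> setT) _ _ (mrestr P mXB) (mscale r P) cylinders_offI) => //.
- move=> _; exists [::], (fun=> setT); split=> //.
  by apply/seteqP; split=> w.
- by rewrite bigcup_const //; exists 0%N.
- move=> _ [s [C [us i0s mC ->]]].
  change (P (\bigcap_(i in [set` s]) X i @^-1` C i `&` X i0 @^-1` B) =
    ((r%:num)%:E * P (\bigcap_(i in [set` s]) X i @^-1` C i))%E).
  rewrite rE.
  (* [D] is the family [C] with [B] inserted at [i0]. The type of [B] depends on the index, hence
     the transport along the equality [i = i0]. *)
  pose D i : set (S i) := match eqVneq i i0 with
    | EqNotNeq e => eq_rect_r (fun j => set (S j)) B e
    | _ => C i end.
  have Di0 : D i0 = B.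
    rewrite /D; case: eqVneq => [e|/eqP//].
    by rewrite (eq_irrelevance e erefl).
  have Dj i : i \in s -> D i = C i.
    rewrite /D; case: eqVneq => // e is_; exfalso.
    by move: i0s; rewrite -[in X in X -> _]e is_.
  have mD i : measurable (D i).
    rewrite /D; case: eqVneq => // e; subst i => //.
  have := indep.2 (i0 :: s) D _ mD; rewrite /= i0s us => /(_ isT).
  have -> : \bigcap_(i in [set` i0 :: s]) X i @^-1` D i =
            \bigcap_(i in [set` s]) X i @^-1` C i `&` X i0 @^-1` B.
    apply/seteqP; split=> w /=.
      move=> h; split; last by have := h i0; rewrite /= inE eqxx Di0; exact.
      by move=> i /= is_; have := h i; rewrite /= inE is_ orbT Dj//; exact.
    move=> [h1 h2] i /=; rewrite inE => /orP[/eqP->|is_]; first by rewrite Di0.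
    by rewrite Dj//; exact: h1.
  move=> ->; rewrite big_cons Di0; congr (_ * _)%E.
  rewrite (indep.2 s C us mC) !big_seq; apply: eq_bigr => i is_.
  by rewrite Dj.
- move=> _; change (P ([set: Omega] `&` X i0 @^-1` B) < +oo)%E.
  by rewrite setTI ltey_eq fin_num_measure.
Qed.

Lemma measurable_off i : i != i0 ->
  measurable_fun [set: g_sigma_algebraType cylinders_off] (X i).
Proof.
move=> ii0 _ B mB; rewrite setTI; apply: sub_sigma_algebra.
pose D j : set (S j) := match eqVneq j i with
    | EqNotNeq e => eq_rect_r (fun j => set (S j)) B e
    | _ => setT end.
have Di : D i = B.
  rewrite /D; case: eqVneq => [e'|/eqP//].
  by rewrite (eq_irrelevance e' erefl).
exists [:: i], D; split => //.
- by rewrite inE eq_sym.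
- move=> j; rewrite /D; case: eqVneq => // e'; subst j => //.
- apply/seteqP; split=> w /=; first by move=> wB j /=; rewrite inE => /eqP->; rewrite /= Di.
  by move=> /(_ i); rewrite /= inE eqxx Di; exact.
Qed.

End SigmaOthers.

Section IndepFubini.
Context (R : realType) (dO dS : measure_display) (Omega : measurableType dO)
  (P : probability Omega R) (S : measurableType dS) (G : set (set Omega))
  (Y : Omega -> S).
Hypothesis Gm : G `<=` measurable.
Hypothesis mY : measurable_fun [set: Omega] Y.
Hypothesis GY : forall A B, <<s G >> A -> measurable B ->
  (P (A `&` Y @^-1` B) = P A * P (Y @^-1` B))%E.

Local Notation OG := (g_sigma_algebraType G).
Local Notation OGS := ((OG : measurableType _) * S)%type.

Lemma measurable_sub_sigma (A : set Omega) : <<s G >> A -> measurable A.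
Proof. exact: (smallest_sub (@sigma_algebra_measurable _ Omega) Gm). Qed.

Lemma measurable_fun_sub_sigma d' (T : measurableType d') (h : Omega -> T) :
  measurable_fun [set: OG] h -> measurable_fun [set: Omega] h.
Proof.
move=> mh _ B mB; rewrite setTI; apply: measurable_sub_sigma.
by have := mh measurableT B mB; rewrite setTI.
Qed.

(** The identity into the coarser sigma-algebra plays the role of the past. Viewed as a random
    variable, it has a joint law with [Y], and independence makes that law a product. *)
Let mid : measurable_fun [set: Omega] (id : Omega -> OG).
Proof. by move=> _ B mB; rewrite setTI; apply: measurable_sub_sigma. Qed.

Let mpair : measurable_fun [set: Omega] ((fun w => (w, Y w)) : Omega -> (OG * S)%type).
Proof. exact: measurable_fun_pair. Qed.

Let mid_mixin := isMeasurableFun.Build _ _ _ _ _ mid.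
Let idG : {mfun Omega >-> OG} := HB.pack (id : Omega -> OG) mid_mixin.
Let mY_mixin := isMeasurableFun.Build _ _ _ _ _ mY.
Let Yf : {mfun Omega >-> S} := HB.pack Y mY_mixin.
Let mpair_mixin := isMeasurableFun.Build _ _ _ _ _ mpair.
Let pairf : {mfun Omega >-> (OG * S)%type} :=
  HB.pack ((fun w => (w, Y w)) : Omega -> (OG * S)%type) mpair_mixin.

Let m1 := distribution P idG.
Let m2 := distribution P Yf.
Let m := distribution P pairf.

(** By [GY] the two measures agree on rectangles, and rectangles determine the product measure. *)
Let m1m2 A : measurable A -> (m1 \x m2)%E A = m A.
Proof.
apply: product_measure_unique => {}A B mA mB.
by rewrite /m /m1 /m2 /distribution /pushforward /= -GY.
Qed.

Lemma indep_tonelli (phi : OGS -> \bar R) :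
  measurable_fun setT phi -> (forall p, 0 <= phi p)%E ->
  (\int[P]_w phi (w, Y w) = \int[P]_w \int[P]_w' phi (w, Y w'))%E.
Proof.
move=> mphi phi0.
transitivity (\int[m]_p phi p)%E; first by rewrite /m ge0_integral_distribution.
transitivity (\int[m1 \x m2]_p phi p)%E.
  by apply: eq_measure_integral => A mA _; exact/esym/m1m2.
rewrite fubini_tonelli1 // /m1 ge0_integral_distribution /=.
- apply: eq_integral => w _; rewrite /fubini_F /m2 ge0_integral_distribution//.
  by apply: measurableT_comp => //; exact: measurable_pair1.
- exact: measurable_fun_fubini_tonelli_F.
- by move=> w; apply: integral_ge0.
Qed.

(** The signed version: integrability is carried from [P] to the joint law and then to the product
    law. Integrability at each frozen [w] serves to turn the inner integral over the law of [Y] into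
    one over [P]. *)
Lemma indep_fubini (phi : OGS -> \bar R) :
  measurable_fun setT phi -> P.-integrable setT (fun w => phi (w, Y w)) ->
  (forall w, P.-integrable setT (fun w' => phi (w, Y w'))) ->
  (\int[P]_w phi (w, Y w) = \int[P]_w \int[P]_w' phi (w, Y w'))%E.
Proof.
move=> mphi iphi iphiw.
have im : m.-integrable setT phi.
  by apply: integrable_pushforward.
have im12 : (m1 \x m2)%E.-integrable setT phi.
  apply/integrableP; split=> //; move/integrableP : im => [_]; congr (_ < _)%E.
  by apply: eq_measure_integral => A mA _; exact/esym/m1m2.
transitivity (\int[m]_p phi p)%E; first by rewrite /m integral_distribution.
transitivity (\int[m1 \x m2]_p phi p)%E.
  by apply: eq_measure_integral => A mA _; exact/esym/m1m2.
rewrite -integral12_prod_meas1 //.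
have mF : measurable_fun [set: OG] (fubini_F m2 phi) by exact: measurable_fubini_F im12.
have iF := integrable_fubini_F im12.
have FE : fubini_F m2 phi = fun w => (\int[P]_w' phi (w, Y w'))%E.
  apply/funext => w.
  rewrite /fubini_F /m2 integral_distribution//; last exact: iphiw.
  by apply: measurableT_comp => //; exact: measurable_pair1.
rewrite -/(fubini_F m2 phi) FE in mF iF *.
rewrite /m1 integral_distribution//.
apply/integrableP; split; first exact: measurable_fun_sub_sigma mF.
move/integrableP : iF => [_].
rewrite ge0_integral_distribution//.
exact: measurableT_comp.
Qed.

End IndepFubini.

(** * Square-integrable random vectors *)

Section RandomVectors.
Context {R : realType} {d : nat}.

Definition mvec {dT} {T : measurableType dT} (x : T -> 'rV[R]_d) : Prop :=
  forall j, measurable_fun [set: T] (fun w => x w 0 j).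

Lemma mxdot_rV (u v : 'rV[R]_d) : mxdot u v = \sum_j u 0 j * v 0 j.
Proof. by rewrite /mxdot big_ord1. Qed.

Section Algebra.
Context {dT} {T : measurableType dT}.
Implicit Types x y : T -> 'rV[R]_d.

Lemma mvec_cst c : mvec (fun _ : T => c).
Proof. by move=> j; exact: measurable_cst. Qed.

Lemma mvecD x y : mvec x -> mvec y -> mvec (fun w => x w + y w).
Proof.
move=> mx my j; under eq_fun do rewrite mxE.
exact: measurable_funD.
Qed.

Lemma mvecZ (a : R) x : mvec x -> mvec (fun w => a *: x w).
Proof.
move=> mx j; under eq_fun do rewrite mxE.
by apply: measurable_funM; [exact: measurable_cst|exact: mx].
Qed.

Lemma mvecB x y : mvec x -> mvec y -> mvec (fun w => x w - y w).
Proof.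
move=> mx my; apply: mvecD => //.
by move=> j; have := mvecZ (-1) my j; under eq_fun do rewrite scaleN1r.
Qed.

Lemma mvec_sum (I : Type) (r : seq I) (F : I -> T -> 'rV[R]_d) :
  (forall i, mvec (F i)) -> mvec (fun w => \sum_(i <- r) F i w).
Proof.
move=> mF j; under eq_fun do rewrite summxE.
by apply: measurable_sum => i; exact: mF.
Qed.

Lemma measurable_mxdot x y :
  mvec x -> mvec y -> measurable_fun [set: T] (fun w => mxdot (x w) (y w)).
Proof.
move=> mx my; under eq_fun do rewrite mxdot_rV.
apply: measurable_sum => i; apply: measurable_funM; [exact: mx|exact: my].
Qed.

Lemma measurable_l2norm_sqr x :
  mvec x -> measurable_fun [set: T] (fun w => l2norm (x w) ^+ 2).
Proof. by move=> mx; under eq_fun do rewrite l2norm_sqr; exact: measurable_mxdot. Qed.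

Lemma measurable_joint dS (S : measurableType dS) (g : 'rV[R]_d -> S -> 'rV[R]_d)
    x (y : T -> S) :
  jointly_measurable g -> mvec x -> measurable_fun [set: T] y ->
  mvec (fun w => g (x w) (y w)).
Proof.
move=> mg mx my j.
(* Joint measurability is stated on tuples, so the vector passes through its tuple of
   coordinates. *)
pose tx w : d.-tuple R := [tuple x w 0 i | i < d].
have mtx : measurable_fun [set: T] tx.
  apply/measurable_fun_tnthP => i; have := mx i.
  by congr measurable_fun; apply/funext => w; rewrite /= tnth_mktuple.
have := measurableT_comp (mg j) (measurable_fun_pair mtx my).
congr measurable_fun; apply/funext => w /=; congr (g _ _ 0 j).
by apply/rowP => i; rewrite mxE tnth_mktuple.
Qed.

End Algebra.

(** [m] is given only as a mean of [g]; it is measurable as a difference of two Tonelli integrals,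
    of the positive and the negative part. This is how the gradients of the objectives become
    measurable along random points. *)
Lemma measurable_mean dO (Omega : measurableType dO) (P : probability Omega R)
    dS (S : measurableType dS) (g : 'rV[R]_d -> S -> 'rV[R]_d) (Y : Omega -> S)
    (m : 'rV[R]_d -> 'rV[R]_d) dT (T : measurableType dT) (x : T -> 'rV[R]_d) :
  jointly_measurable g -> measurable_fun [set: Omega] Y ->
  (forall x j, 'E_P[(fun w => g x (Y w) 0 j)%R] = (m x 0 j)%:E)%E ->
  mvec x -> mvec (fun w => m (x w)).
Proof.
move=> mg mY gm mx j.
pose phi (p : T * Omega) := (g (x p.1) (Y p.2) 0 j)%:E.
have mphi : measurable_fun setT phi.
  apply/measurable_EFinP.
  apply: (@measurable_joint _ (T * Omega)%type _ S g (x \o fst) (Y \o snd)) => //.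
  - by move=> i; apply: (measurableT_comp (mx i)).
  - exact: measurableT_comp.
have -> : (fun w => m (x w) 0 j) = (fun w => fine (\int[P]_w' phi (w, w')))%E.
  by apply/funext => w; have := gm (x w) j; rewrite unlock => ->.
apply: measurableT_comp => //.
under eq_fun do rewrite integralE.
apply: emeasurable_funB.
- rewrite (_ : (fun w => _) = fubini_F P phi^\+%E).
    by apply: measurable_fun_fubini_tonelli_F => //; exact: measurable_funepos.
  by apply/funext => w; apply: eq_integral => v _; rewrite !funeposE.
- rewrite (_ : (fun w => _) = fubini_F P phi^\-%E).
    by apply: measurable_fun_fubini_tonelli_F => //; exact: measurable_funeneg.
  by apply/funext => w; apply: eq_integral => v _; rewrite !funenegE.
Qed.

Section SquareIntegrable.
Context {dO} {Omega : measurableType dO} (P : probability Omega R).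
Implicit Types x y : Omega -> 'rV[R]_d.

Definition sqint x : Prop :=
  mvec x /\ P.-integrable [set: Omega] (fun w => (l2norm (x w) ^+ 2)%:E).

Lemma sqint_le x (B : R) : mvec x ->
  (\int[P]_w (l2norm (x w) ^+ 2)%:E <= B%:E)%E -> sqint x.
Proof.
move=> mx xB; split=> //; apply/integrableP; split.
  exact/measurable_EFinP/measurable_l2norm_sqr.
apply: (le_lt_trans _ (ltry B)); apply: le_trans xB.
by under eq_integral => w _ do rewrite gee0_abs ?lee_fin ?sqr_ge0//.
Qed.

Lemma sqint_bounded x (B : R) : mvec x -> (forall w, l2norm (x w) ^+ 2 <= B) -> sqint x.
Proof.
move=> mx xB; apply: (@sqint_le x B) => //.
rewrite (@le_trans _ _ (\int[P]_w B%:E)%E)//.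
  apply: ge0_le_integral => //.
  - by move=> w _; rewrite lee_fin sqr_ge0.
  - exact/measurable_EFinP/measurable_l2norm_sqr.
  - by move=> w _; rewrite lee_fin.
by have := expectation_cst P B; rewrite unlock => /= ->.
Qed.

Lemma integrable_mxdot x y : sqint x -> sqint y ->
  P.-integrable [set: Omega] (fun w => (mxdot (x w) (y w))%:E).
Proof.
move=> [mx ix] [my iy].
apply: (@le_integrable _ _ _ _ _ measurableT _
  (fun w => (l2norm (x w) ^+ 2)%:E + (l2norm (y w) ^+ 2)%:E)%E).
- exact/measurable_EFinP/measurable_mxdot.
- move=> w _; rewrite -EFinD !abse_EFin lee_fin ler_norml.
  rewrite ger0_norm ?addr_ge0 ?sqr_ge0//.
  have h1 := mxdot_young (x w) (y w).
  have h2 := mxdot_young (- x w) (y w).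
  rewrite mxdotNl l2normN in h2.
  have p1 : 0 <= l2norm (x w) ^+ 2 by rewrite sqr_ge0.
  have p2 : 0 <= l2norm (y w) ^+ 2 by rewrite sqr_ge0.
  by apply/andP; split; lra.
- exact: integrableD.
Qed.

(** A coordinate is the inner product with a basis vector, which is constant and hence
    square-integrable. *)
Lemma integrable_coord x j : sqint x ->
  P.-integrable [set: Omega] (fun w => (x w 0 j)%:E).
Proof.
move=> sx.
have sd : sqint (fun=> delta_mx 0 j) by apply: (sqint_bounded (mvec_cst _) (fun=> lexx _)).
have := integrable_mxdot sd sx; congr (P.-integrable _ _).
apply/funext => w; rewrite mxdot_rV (bigD1 j)//= mxE !eqxx mul1r big1 ?addr0//.
by move=> i ij; rewrite mxE eqxx (negbTE ij) mul0r.
Qed.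

Lemma sqintZ (a : R) x : sqint x -> sqint (fun w => a *: x w).
Proof.
move=> [mx ix]; split; first exact: mvecZ.
under eq_fun do rewrite l2normZ exprMn EFinM.
exact: integrableZl.
Qed.

Lemma sqintD x y : sqint x -> sqint y -> sqint (fun w => x w + y w).
Proof.
move=> [mx ix] [my iy]; split; first exact: mvecD.
apply: (@le_integrable _ _ _ _ _ measurableT _
  (fun w => 2%:E * ((l2norm (x w) ^+ 2)%:E + (l2norm (y w) ^+ 2)%:E))%E).
- exact/measurable_EFinP/measurable_l2norm_sqr/mvecD.
- move=> w _; rewrite -EFinD -EFinM !abse_EFin lee_fin.
  rewrite (ger0_norm (sqr_ge0 _)) ger0_norm ?l2normD_sqr// mulr_ge0// addr_ge0 ?sqr_ge0//.
- by apply: integrableZl => //; exact: integrableD.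
Qed.

Lemma sqintB x y : sqint x -> sqint y -> sqint (fun w => x w - y w).
Proof.
move=> sx sy; have := sqintD sx (sqintZ (-1) sy).
by congr sqint; apply/funext => w; rewrite scaleN1r.
Qed.

Lemma sqint0 : sqint (fun=> 0).
Proof. by apply: (@sqint_bounded _ 0); [exact: mvec_cst|move=> w; rewrite l2norm0 expr0n]. Qed.

Lemma sqint_sum (I : Type) (r : seq I) (F : I -> Omega -> 'rV[R]_d) :
  (forall i, sqint (F i)) -> sqint (fun w => \sum_(i <- r) F i w).
Proof.
move=> sF; elim: r => [|i r IHr].
  by have := sqint0; congr sqint; apply/funext => w; rewrite big_nil.
have := sqintD (sF i) IHr.
by congr sqint; apply/funext => w; rewrite big_cons.
Qed.

End SquareIntegrable.

End RandomVectors.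

Section IndependentNoise.
Context (R : realType) (d : nat) (dO dS : measure_display) (Omega : measurableType dO)
  (P : probability Omega R) (S : measurableType dS) (G : set (set Omega))
  (Y : Omega -> S).
Hypothesis Gm : G `<=` measurable.
Hypothesis mY : measurable_fun [set: Omega] Y.
Hypothesis GY : forall A B, <<s G >> A -> measurable B ->
  (P (A `&` Y @^-1` B) = P A * P (Y @^-1` B))%E.

Local Notation OG := (g_sigma_algebraType G : measurableType _).

Variables (g : 'rV[R]_d -> S -> 'rV[R]_d) (m : 'rV[R]_d -> 'rV[R]_d).
Hypothesis mg : jointly_measurable g.
Hypothesis gm :
  forall x j, ('E_P[(fun w => g x (Y w) 0 j)%R] = (m x 0 j)%:E)%E.

Lemma mvec_sub_sigma (x : Omega -> 'rV[R]_d) : mvec (x : OG -> _) -> mvec x.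
Proof. by move=> mx j; apply: (measurable_fun_sub_sigma Gm (mx j)). Qed.

Variable x : Omega -> 'rV[R]_d.
Hypothesis mx : mvec (x : OG -> 'rV[R]_d).

Let mgx : mvec (fun p : (OG * S)%type => g (x p.1) p.2).
Proof.
apply: measurable_joint => //.
by move=> j; apply: (measurableT_comp (mx j)).
Qed.

Let mmx : mvec (fun p : (OG * S)%type => m (x p.1)).
Proof.
apply: (measurable_mean mg mY gm).
by move=> j; apply: (measurableT_comp (mx j)).
Qed.

(** Tonelli freezes the past: for each [w] the inner integral is the second moment at the fixed
    point [c = x w], where the assumed bound applies. *)
Lemma indep_second_moment (k : 'rV[R]_d -> S -> 'rV[R]_d) (B : R) :
  mvec (fun p : (OG * S)%type => k (x p.1) p.2) ->
  (forall c, (\int[P]_w (l2norm (k c (Y w)) ^+ 2)%:E <= B%:E)%E) ->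
  (\int[P]_w (l2norm (k (x w) (Y w)) ^+ 2)%:E <= B%:E)%E.
Proof.
move=> mk kB.
pose phi (p : (OG * S)%type) := (l2norm (k (x p.1) p.2) ^+ 2)%:E.
have mphi : measurable_fun setT phi.
  exact/measurable_EFinP/measurable_l2norm_sqr.
have phi0 p : (0 <= phi p)%E by rewrite lee_fin sqr_ge0.
rewrite (indep_tonelli Gm mY GY mphi phi0).
rewrite (@le_trans _ _ (\int[P]_w B%:E)%E)//; last first.
  by have := expectation_cst P B; rewrite unlock => /= ->.
apply: ge0_le_integral => //.
- by move=> w _; apply: integral_ge0.
- apply: (measurable_fun_sub_sigma Gm).
  apply: (@measurable_fun_fubini_tonelli_F _ _ (OG : measurableType _) _ _ P
    (fun p => phi (p.1, Y p.2))) => //.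
  apply: (measurableT_comp mphi); apply: measurable_fun_pair => //.
  exact: measurableT_comp.
- by move=> w _; exact: (kB (x w)).
Qed.

Lemma grad_second_moment (B : R) :
  (forall c, (\int[P]_w (l2norm (g c (Y w)) ^+ 2)%:E <= B%:E)%E) ->
  (\int[P]_w (l2norm (g (x w) (Y w)) ^+ 2)%:E <= B%:E)%E.
Proof. exact: indep_second_moment. Qed.

Lemma noise_second_moment (B : R) :
  (forall c, (\int[P]_w (l2norm (g c (Y w) - m c) ^+ 2)%:E <= B%:E)%E) ->
  (\int[P]_w (l2norm (g (x w) (Y w) - m (x w)) ^+ 2)%:E <= B%:E)%E.
Proof.
apply: (@indep_second_moment (fun c z => g c z - m c)).
exact: mvecB.
Qed.

Lemma noise_orthogonal (B : R) (v : Omega -> 'rV[R]_d) :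
  (forall c, (\int[P]_w (l2norm (g c (Y w) - m c) ^+ 2)%:E <= B%:E)%E) ->
  mvec (v : OG -> _) -> sqint P v ->
  (\int[P]_w (mxdot (v w) (g (x w) (Y w) - m (x w)))%:E = 0)%E.
Proof.
move=> gB mv iv.
have mgc c : mvec (fun w => g c (Y w)).
  by apply: measurable_joint => //; exact: mvec_cst.
have inoise c : sqint P (fun w => g c (Y w) - m c).
  by apply: sqint_le (gB c); apply: mvecB => //; exact: mvec_cst.
have igc c : sqint P (fun w => g c (Y w)).
  have := sqintD (inoise c) (sqint_bounded P (mvec_cst (m c)) (fun=> lexx _)).
  by congr sqint; apply/funext => w; rewrite subrK.
pose phi (p : (OG * S)%type) := (mxdot (v p.1) (g (x p.1) p.2 - m (x p.1)))%:E.
rewrite (@indep_fubini _ _ _ _ P _ _ _ Gm mY GY phi).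
(* For a frozen past the inner integral is a linear combination of the coordinates of the noise at a
   fixed point, and each of them has mean zero. *)
- rewrite integral0_eq// => w _; rewrite /phi /=.
  under eq_integral do rewrite mxdot_rV -sumEFin.
  have ic j := integrable_coord j (inoise (x w)).
  rewrite integral_sum//=; last by move=> j; under eq_fun do rewrite EFinM; exact: integrableZl.
  rewrite big1// => j _; under eq_integral do rewrite EFinM.
  rewrite integralZl//; under eq_integral do rewrite !mxE EFinB.
  rewrite integralB_EFin//; [|exact: integrable_coord (igc _)|].
    have := gm (x w) j; rewrite unlock => ->.
    by have := expectation_cst P (m (x w) 0 j); rewrite unlock => /= ->; rewrite subee// mule0.
  exact: finite_measure_integrable_cst.
- apply/measurable_EFinP/measurable_mxdot; last exact: mvecB.
  by move=> j; apply: (measurableT_comp (mv j)).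
- apply: (integrable_mxdot iv).
  apply: sqint_le (noise_second_moment gB).
  apply: mvecB.
    apply: measurable_joint => //; exact: mvec_sub_sigma.
  apply: (measurable_mean mg mY gm); exact: mvec_sub_sigma.
- move=> w; rewrite /phi /=.
  by apply: (@integrable_mxdot _ _ _ _ P (fun=> v w)) => //; apply: (sqint_bounded P (mvec_cst _) (fun=> lexx _)).
Qed.

End IndependentNoise.

(** * Smooth objectives *)

Section SmoothFunctions.
Context {R : realType} {d : nat}.
Implicit Types (f : 'rV[R]_d -> R) (x v : 'rV[R]_d).

Lemma derive_grad f x v : differentiable f x -> 'D_v f x = mxdot (grad f x) v.
Proof.
move=> df; rewrite deriveE// [in LHS](row_sum_delta v) linear_sum /mxdot big_ord1.
apply: eq_bigr => j _; rewrite linearZ /= mulrC mxE.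
by rewrite deriveE.
Qed.

Lemma is_derive_line f x v (s : R) : differentiable f (x + s *: v) ->
  is_derive s 1 (fun r => f (x + r *: v)) (mxdot (grad f (x + s *: v)) v).
Proof.
move=> df; rewrite -derive_grad//.
have E : (fun h => h^-1 *: ((((fun r => f (x + r *: v)) \o shift s) (h *: (1 : R)) -
    f (x + s *: v)) : R)) =
  (fun h => h^-1 *: (((f \o shift (x + s *: v)) (h *: v) - f (x + s *: v)) : R)).
  apply/funext => h /=; congr (_ *: (f _ - _)).
  by rewrite [h *: 1]mulr1 scalerDl addrCA.
apply: DeriveDef; rewrite /derivable /derive E//.
exact: (diff_derivable df).
Qed.

(** [psi] is the gap between [f] on the segment from [x] to [x + v] and its quadratic upper model.
    Cauchy-Schwarz and the Lipschitz bound on the gradient make its derivative nonpositive, so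
    [psi 1 <= psi 0]. *)
Lemma smooth_descent (L : R) f x v : smooth L f ->
  f (x + v) <= f x + mxdot (grad f x) v + L / 2 * l2norm v ^+ 2.
Proof.
move=> [df fL].
pose a := mxdot (grad f x) v; pose b := L / 2 * l2norm v ^+ 2.
pose psi := (fun r : R => f (x + r *: v)) - ((fun r => a * r) + (fun r => b * r ^+ 2)).
have dpsi (s : R) : is_derive s 1 psi
    (mxdot (grad f (x + s *: v)) v - (a + b * (2 * s))).
  apply: is_deriveB; first exact: is_derive_line.
  apply: is_deriveD.
    apply: is_derive_eq (is_deriveZ a (is_derive_id s 1)) _.
    by rewrite [_ *: _]mulr1.
  apply: is_derive_eq (is_deriveZ b (is_deriveX 2 (is_derive_id s 1))) _.
  by rewrite /= expr1 /GRing.scale/= mulr1.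
have := @ler0_derive1_nincr R psi 0 1 _ _ _ 0 1 (lexx _) ler01 (lexx _).
rewrite /psi !fctE /=.
have -> : (x + 1 *: v) = x + v by rewrite scale1r.
have -> : (x + 0 *: v) = x by rewrite scale0r addr0.
rewrite mulr0 expr0n mulr0 expr1n !mulr1 !addr0 subr0 /a /b => h.
suff : f (x + v) - (mxdot (grad f x) v + L / 2 * l2norm v ^+ 2) <= f x by lra.
apply: h.
- by move=> s _; have [] := dpsi s.
- move=> s; rewrite in_itv /= => /andP[s0 s1].
  rewrite derive1E; have [_ ->] := dpsi s.
  have := mxdot_CS (grad f (x + s *: v) - grad f x) v.
  have := fL x (x + s *: v); rewrite (addrC x) addrK l2normZ gtr0_norm// => h1 h2.
  have h3 : l2norm (grad f (s *: v + x) - grad f x) * l2norm v <=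
            L * (s * l2norm v) * l2norm v by rewrite ler_wpM2r ?l2norm_ge0.
  rewrite mxdotBl -/a in h2; rewrite /b.
  have -> : a + L / 2 * l2norm v ^+ 2 * (2 * s) = a + L * (s * l2norm v) * l2norm v.
    by field.
  lra.
- apply: continuous_subspaceT => s; apply: differentiable_continuous.
  by apply/derivable1_diffP; have [] := dpsi s.
Qed.

(** Move from [x] along [- g x]: the quadratic upper bound on [f] cannot fall below [fstar]. It
    takes the descent inequality as a hypothesis, so that it applies directly to the averaged
    objective. *)
Lemma descent_grad_bound (L fstar : R) f (g : 'rV[R]_d -> 'rV[R]_d) x : 0 <= L ->
  (forall x v, f (x + v) <= f x + mxdot (g x) v + L / 2 * l2norm v ^+ 2) ->
  (forall x, fstar <= f x) ->
  l2norm (g x) ^+ 2 <= 2 * L * (f x - fstar).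
Proof.
move=> L0 fd fs; set G2 := l2norm (g x) ^+ 2.
have G20 : 0 <= G2 by rewrite sqr_ge0.
have key (s : R) : s * G2 - L / 2 * s ^+ 2 * G2 <= f x - fstar.
  have := le_trans (fs _) (fd x (- s *: g x)).
  rewrite mxdotZr l2normZ normrN exprMn real_normK ?num_real// -l2norm_sqr -/G2; lra.
move: L0; rewrite le_eqVlt => /orP[/eqP L0|L0].
  rewrite -L0 in key *; rewrite mulr0 mul0r.
  rewrite leNgt; apply/negP => Gp.
  (* For [L = 0] the bound is linear in [s]; a nonzero gradient and this [s] would make the decrease
     exceed [f x - fstar] by 1. *)
  have := key ((f x - fstar + 1) / G2).
  rewrite mul0r mul0r mul0r subr0 divfK ?gt_eqF//; lra.
(* The stepsize [L^-1] minimises the quadratic upper bound. *)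
have := key L^-1.
have -> : L^-1 * G2 - L / 2 * L^-1 ^+ 2 * G2 = G2 / (2 * L) by field; lra.
by rewrite ler_pdivrMr ?mulr_gt0// mulrC.
Qed.

End SmoothFunctions.

Section AverageObjective.
Context {R : realType} {N d : nat} (f : 'I_N -> 'rV[R]_d -> R) (L : R).
Hypothesis fL : forall n, smooth L (f n).
Hypothesis N0 : (0 < N)%N.

Let favg x := N%:R^-1 * \sum_n f n x.

Lemma grad_avg x : grad favg x = N%:R^-1 *: \sum_n grad (f n) x.
Proof.
apply/rowP => j; rewrite !mxE summxE.
have -> : favg = N%:R^-1 \*: (\sum_n f n).
  by apply/funext => y; rewrite /favg fct_sumE.
have df n : derivable (f n) x (delta_mx 0 j) by apply: diff_derivable; case: (fL n).
rewrite deriveZ; last exact: derivable_sum.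
by rewrite derive_sum//; congr (_ * _); apply: eq_bigr => n _; rewrite mxE.
Qed.

Lemma avg_descent x v :
  favg (x + v) <= favg x + mxdot (grad favg x) v + L / 2 * l2norm v ^+ 2.
Proof.
rewrite grad_avg mxdotZl mxdot_suml /favg.
have NR : 0 < N%:R :> R by rewrite ltr0n.
rewrite -(ler_pM2l NR) !mulrDr !(mulrA N%:R N%:R^-1) divff ?gt_eqF// !mul1r.
rewrite -big_split /= mulr_natl -[X in _ *+ X]card_ord -sumr_const -big_split /=.
by apply: ler_sum => n _; exact: smooth_descent.
Qed.

(** Jensen's inequality moves the square inside the mean over the nodes, and the Lipschitz bound is
    then applied node by node. *)
Lemma avg_grad_dist (x : 'rV[R]_d) (y : 'I_N -> 'rV[R]_d) : 0 <= L ->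
  l2norm (grad favg x - N%:R^-1 *: \sum_n grad (f n) (y n)) ^+ 2 <=
  L ^+ 2 / N%:R * \sum_n l2norm (y n - x) ^+ 2.
Proof.
move=> L0; have NR : 0 < N%:R :> R by rewrite ltr0n.
rewrite grad_avg -scalerBr l2normZ exprMn gtr0_norm ?invr_gt0// -sumrB.
apply: (@le_trans _ _ (N%:R^-1 ^+ 2 * (N%:R * \sum_n (L ^+ 2 * l2norm (y n - x) ^+ 2)))).
  rewrite ler_pM2l ?exprn_gt0 ?invr_gt0//.
  apply: (le_trans (l2norm_sqr_sum _)); rewrite card_ord ler_pM2l//.
  apply: ler_sum => n _; rewrite -l2normN opprB -exprMn.
  by rewrite lerXn2r ?nnegrE ?mulr_ge0 ?l2norm_ge0//; case: (fL n).
by rewrite -mulr_sumr le_eqVlt; apply/orP; left; apply/eqP; field; rewrite gt_eqF.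
Qed.

End AverageObjective.

(** * Limits of the powers of the extended matrix *)

Section EntrywiseLimits.
Context {R : realType}.

(** Convergence is taken entrywise so that limits pass through a matrix product as limits of finite
    sums of real products. *)
Definition mxcvg m n (A : nat -> 'M[R]_(m, n)) (B : 'M[R]_(m, n)) : Prop :=
  forall i j, (fun t : nat => A t i j) @ \oo --> B i j.

Lemma cvg_mxcvg m n (A : nat -> 'M[R]_(m, n)) (B : 'M[R]_(m, n)) :
  A @ \oo --> B -> mxcvg A B.
Proof.
move=> AB i j.
exact: (@cvg_comp _ _ _ A (fun M : 'M[R]_(m, n) => M i j) _ _ _ AB
  (@coord_continuous _ _ _ i j B)).
Qed.

Lemma mxcvg_unique m n (A : nat -> 'M[R]_(m, n)) (B C : 'M[R]_(m, n)) :
  mxcvg A B -> mxcvg A C -> B = C.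
Proof.
move=> AB AC; apply/matrixP => i j.
by rewrite -(cvg_lim _ (AB i j))// -(cvg_lim _ (AC i j)).
Qed.

Lemma mxcvg_shift m n (A : nat -> 'M[R]_(m, n)) (B : 'M[R]_(m, n)) :
  mxcvg A B -> mxcvg (fun t => A t.+1) B.
Proof. by move=> AB i j; have := AB i j; rewrite -cvg_shiftS. Qed.

Lemma cvg_sumr (I : Type) (r : seq I) (F : I -> nat -> R) (l : I -> R) :
  (forall i, F i @ \oo --> l i) ->
  (fun t => \sum_(i <- r) F i t) @ \oo --> \sum_(i <- r) l i.
Proof.
move=> Fl; elim: r => [|i r IHr].
  by rewrite big_nil; under eq_fun do rewrite big_nil; exact: cvg_cst.
by rewrite big_cons; under eq_fun do rewrite big_cons; exact: cvgD.
Qed.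

Lemma mxcvg_mulr m n p (A : nat -> 'M[R]_(m, n)) (B : 'M[R]_(m, n))
    (C : 'M[R]_(n, p)) : mxcvg A B -> mxcvg (fun t => A t *m C) (B *m C).
Proof.
move=> AB i j; rewrite mxE; under eq_fun do rewrite mxE.
by apply: cvg_sumr => l; apply: cvgM; [exact: AB|exact: cvg_cst].
Qed.

Lemma mxcvg_mull m n p (C : 'M[R]_(m, n)) (A : nat -> 'M[R]_(n, p))
    (B : 'M[R]_(n, p)) : mxcvg A B -> mxcvg (fun t => C *m A t) (C *m B).
Proof.
move=> AB i j; rewrite mxE; under eq_fun do rewrite mxE.
by apply: cvg_sumr => l; apply: cvgM; [exact: cvg_cst|exact: AB].
Qed.

End EntrywiseLimits.

(** * Stochasticity of the extended matrix, stationarity and positivity of its limit row *)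

Section ExtendedMatrix.
Context {R : realType} {N : nat} (e : rel 'I_N) (k : 'I_N -> 'I_N -> nat).

Local Notation vnode := (vnode e k).
Local Notation ext_size := (ext_size e k).
Local Notation ed := (edge_delay e k).

Definition index_of (a : 'I_N + vnode) : 'I_ext_size :=
  match a with
  | inl n => lshift _ n
  | inr v => rshift N (enum_rank v)
  end.

Lemma index_ofK a : node_of (index_of a) = a.
Proof.
case: a => [n|v]; rewrite /node_of /=; first by rewrite (unsplitK (inl n)).
by rewrite (unsplitK (inr (enum_rank v))) enum_rankK.
Qed.

Lemma node_ofK i : index_of (node_of i) = i.
Proof.
rewrite /node_of; case: (splitP i) => j ij; apply/val_inj; rewrite /= ?enum_valK//.
Qed.

Lemma sum_nodes (V : nmodType) (F : 'I_ext_size -> V) :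
  \sum_i F i = \sum_n F (index_of (inl n)) + \sum_v F (index_of (inr v)).
Proof.
rewrite big_split_ord; congr (_ + _).
rewrite (reindex (@enum_rank vnode))//.
by apply: onW_bij; exact: enum_rank_bij.
Qed.

Variable W : 'M[R]_N.
Local Notation We := (ext_matrix e k W).
Hypothesis eW : gossip_matrix e W.

Lemma ext_matrixE a b : We (index_of a) (index_of b) = ext_weight W a b.
Proof. by rewrite mxE !index_ofK. Qed.

Lemma sum_vnodes (F : forall mn, 'I_(ed mn) -> R) :
  \sum_(v : vnode) F (tag v) (tagged v) = \sum_mn \sum_(j < ed mn) F mn j.
Proof. by rewrite sig_big_dep. Qed.

(** In the row of an original node [n], each [m] contributes [W n m] exactly once: directly when the
    delay is zero, through the last virtual node of the path otherwise. *)
Lemma ext_matrix_row_sum i : \sum_j We i j = 1.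
Proof.
rewrite -(node_ofK i) sum_nodes; under eq_bigr do rewrite ext_matrixE.
under [X in _ + X]eq_bigr do rewrite ext_matrixE.
case: (node_of i) => [n|[mn j]] /=.
  rewrite (sum_vnodes (fun mn j =>
    if (mn.2 == n) && (j.+1 == ed mn) then W n mn.1 else 0)).
  have last_sum mn : \sum_(j < ed mn)
      (if (mn.2 == n) && (j.+1 == ed mn) then W n mn.1 else 0) =
      if (mn.2 == n) && (ed mn != 0%N) then W n mn.1 else 0.
    case: (ed mn) => [|q]; first by rewrite big_ord0 andbF.
    rewrite big_ord_recr /= eqxx big1 ?add0r// => j _.
    by rewrite eqSS ltn_eqF// andbF.
  under [X in _ + X]eq_bigr do rewrite last_sum.
  rewrite -(pair_bigA _ (fun m n' => if (n' == n) && (ed (m, n') != 0%N) then W n m else 0)).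
  have [W1 _ _ _] := eW; rewrite -(W1 n) -big_split; apply: eq_bigr => m _ /=.
  rewrite (bigD1 n)//= eqxx big1 => [|n' /negbTE->//].
  by case: eqP => _ /=; rewrite ?addr0 ?add0r.
(* A virtual node has a single incoming edge: from [mn.1] when it is the first on its path, from its
   virtual predecessor otherwise. *)
rewrite -mulr_suml (bigD1 mn.1)//= eqxx big1 ?addr0 => [|m]; last first.
  by rewrite eq_sym => /negbTE->.
rewrite mul1r (sum_vnodes (fun mn' j' => (mn == mn')%:R * (j == j'.+1 :> nat)%:R)).
rewrite (bigD1 mn)//= eqxx [X in _ + (_ + X)]big1 => [|mn']; last first.
  by rewrite eq_sym => /negbTE->; rewrite big1// => j' _; rewrite mul0r.
rewrite addr0; case: j => -[|j] jlt /=.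
  by rewrite big1 ?addr0// => j' _; rewrite mulr0.
rewrite add0r (bigD1 (Ordinal (ltnW jlt)))//= eqxx mul1r big1 ?addr0// => j'.
rewrite -val_eqE /= => ne; rewrite eqSS eq_sym (negbTE ne) mulr0//.
Qed.

Lemma ext_matrix_ge0 i j : 0 <= We i j.
Proof.
case: eW => _ W0 _ _; rewrite mxE; case: (node_of i) => [n|u]; case: (node_of j) => [m|v] /=.
- by case: ifP.
- by case: ifP.
- by rewrite mulr_ge0.
- by rewrite mulr_ge0.
Qed.

Section Limit.
Variables (Winf : 'M[R]_ext_size) (pi : 'rV[R]_ext_size).
Hypothesis Wcvg : (fun t : nat => We ^+ t) @ \oo --> Winf.
Hypothesis Wpi : forall i j, Winf i j = pi 0 j.

Let Wmxcvg : mxcvg (fun t => We ^+ t) Winf. Proof. exact: cvg_mxcvg. Qed.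

Let We1 : We *m const_mx 1 = const_mx 1 :> 'cV[R]_ext_size.
Proof.
apply/colP => i; rewrite !mxE -[RHS](ext_matrix_row_sum i).
by apply: eq_bigr => j _; rewrite [X in _ * X]mxE mulr1.
Qed.

(** The products [We ^+ t *m We] form the shifted sequence of powers, so both sides are limits of
    the same sequence. *)
Lemma Winf_mul : Winf *m We = Winf.
Proof.
apply: mxcvg_unique (mxcvg_mulr (C := We) Wmxcvg) _.
rewrite (_ : (fun t => _) = (fun t => We ^+ t.+1)); first exact: (mxcvg_shift Wmxcvg).
by apply/funext => t; rewrite exprSr.
Qed.

Lemma mul_Winf : We *m Winf = Winf.
Proof.
apply: mxcvg_unique (mxcvg_mull (C := We) Wmxcvg) _.
rewrite (_ : (fun t => _) = (fun t => We ^+ t.+1)); first exact: (mxcvg_shift Wmxcvg).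
by apply/funext => t; rewrite exprS.
Qed.

Lemma pow_mul_Winf t : We ^+ t *m Winf = Winf.
Proof.
elim: t => [|t IHt]; first by rewrite expr0 mul1mx.
by rewrite exprSr -mulmxE -mulmxA mul_Winf.
Qed.

Lemma Winf_mul_pow t : Winf *m We ^+ t = Winf.
Proof.
elim: t => [|t IHt]; first by rewrite expr0 mulmx1.
by rewrite exprS -mulmxE mulmxA Winf_mul.
Qed.

Lemma Winf_idem : Winf *m Winf = Winf.
Proof.
apply: mxcvg_unique (mxcvg_mulr (C := Winf) Wmxcvg) _.
by under eq_fun do rewrite pow_mul_Winf; move=> i j; exact: cvg_cst.
Qed.

Let Winf_rows p (X : 'M[R]_(ext_size, p)) i : row i (Winf *m X) = pi *m X.
Proof.
by rewrite row_mul; congr (_ *m _); apply/rowP => j; rewrite mxE Wpi.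
Qed.

Hypothesis N0 : (0 < N)%N.

Let i0 : 'I_ext_size := lshift _ (Ordinal N0).

Lemma limit_row_pow t : pi *m We ^+ t = pi.
Proof.
rewrite -(Winf_rows _ i0) Winf_mul_pow.
by apply/rowP => j; rewrite mxE Wpi.
Qed.

Lemma limit_row_ge0 j : 0 <= pi 0 j.
Proof.
rewrite -(Wpi i0); apply: (cvgr_to_ge (Wmxcvg (i := i0) (j := j))).
apply: nearW => t; elim: t j => [|t IHt] j; first by rewrite expr0 mxE ler0n.
by rewrite exprSr mxE; apply: sumr_ge0 => l _; rewrite mulr_ge0 ?ext_matrix_ge0.
Qed.

(** Every power fixes the vector of ones, hence so does the limit. *)
Lemma limit_row_sum : \sum_j pi 0 j = 1.
Proof.
have H : Winf *m const_mx 1 = const_mx 1 :> 'cV[R]_ext_size.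
  apply: mxcvg_unique (mxcvg_mulr Wmxcvg) _ => i j.
  rewrite (_ : (fun t => _) = (fun=> const_mx 1 i j)); first exact: cvg_cst.
  apply/funext => t; congr ((_ : 'M[R]_(_, _)) i j).
  elim: t => [|t IHt]; first by rewrite expr0 mul1mx.
  by rewrite exprS -mulmxE -mulmxA IHt We1.
have := congr1 (fun M : 'cV[R]_ext_size => M i0 0) H; rewrite !mxE => <-.
by apply: eq_bigr => j _; rewrite mxE mulr1 Wpi.
Qed.

Hypothesis eG : gossip_graph e.

Let p a := pi 0 (index_of a).

(** Stationarity gives [p b >= p a * ext_weight W a b], so positivity travels backwards along the
    edges of the extended graph. *)
Let p_step a b : 0 < p a -> 0 < ext_weight W a b -> 0 < p b.
Proof.
move=> pa ab; apply: (@lt_le_trans _ _ (p a * ext_weight W a b)); first exact: mulr_gt0.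
have -> : p b = (pi *m We ^+ 1) 0 (index_of b) by rewrite limit_row_pow.
rewrite expr1 mxE (bigD1 (index_of a))//= ext_matrixE.
rewrite lerDl; apply: sumr_ge0 => j _; rewrite mulr_ge0 ?ext_matrix_ge0//.
exact: limit_row_ge0.
Qed.

Let p_virtual (v : vnode) : 0 < p (inr v) -> 0 < p (inl (tag v).1).
Proof.
case: v => mn [j jlt] /=; elim: j jlt => [|j IHj] jlt pv.
  by apply: p_step pv _ => /=; rewrite !eqxx mulr1.
apply: (IHj (ltnW jlt)); apply: p_step pv _.
by rewrite /= !eqxx mulr1.
Qed.

Let p_edge m n : e m n -> 0 < p (inl n) -> 0 < p (inl m).
Proof.
move=> emn pn; have [_ W0 W1 _] := eW.
have Wnm : 0 < W n m.
  by rewrite lt0r W0 andbT; apply/negP => /eqP /W1; rewrite emn.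
have [d0|d0] := eqVneq (ed (m, n)) 0%N.
  by apply: p_step pn _; rewrite /= d0 eqxx.
have dlt : ((ed (m, n)).-1 < ed (m, n))%N by rewrite prednK// lt0n.
apply: (@p_virtual (Tagged (fun mn => 'I_(ed mn)) (Ordinal dlt))).
by apply: p_step pn _; rewrite /= eqxx prednK ?lt0n// eqxx.
Qed.

(** Some entry is positive because the entries sum to 1. Following a delayed path back to its tail
    gives an original node [m] with positive weight, and a path from [n] to [m] carries positivity
    back to [n]. *)
Lemma limit_row_gt0 n : 0 < pi 0 (index_of (inl n)).
Proof.
have [m pm] : exists m, 0 < p (inl m).
  have [a pa] : exists a, 0 < p a.
    apply: contrapT => /forallNP np; have := limit_row_sum.
    rewrite big1 => [/eqP|i _]; first by rewrite eq_sym oner_eq0.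
    apply/eqP; rewrite eq_le limit_row_ge0 andbT leNgt; apply/negP => pi0.
    by apply: (np (node_of i)); rewrite /p node_ofK.
  by case: a pa => [m|v] pm; [exists m|exists (tag v).1; exact: p_virtual].
have [_ /(_ n m) /connectP[s es lastm]] := eG.
elim: s n es lastm => [|n' s IHs] n /=; first by move=> _ <-.
by move=> /andP[enn' es] lastm; apply: (p_edge enn'); exact: IHs.
Qed.

Section Averages.
Variable d : nat.
Implicit Types X A : 'M[R]_(ext_size, d).

Lemma weighted_avgE X : weighted_avg pi X = pi *m X.
Proof. by rewrite mulmx_sum_row. Qed.

Lemma row_Winf_mul X i : row i (Winf *m X) = weighted_avg pi X.
Proof. by rewrite Winf_rows weighted_avgE. Qed.

(** On original nodes the correction [1 / (N pi_n)] cancels [pi_n], which requires [pi_n] to be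
    nonzero. The sum over virtual nodes vanishes once the gradients there are zero. *)
Lemma pi_correction A :
  pi *m (correction pi *m A) =
  N%:R^-1 *: (\sum_n row (index_of (inl n)) A)
  + \sum_v pi 0 (index_of (inr v)) *: row (index_of (inr v)) A.
Proof.
rewrite mulmx_sum_row sum_nodes scaler_sumr; congr (_ + _); apply: eq_bigr => a _.
  rewrite /correction row_mul row_diag_mx mxE index_ofK -scalemxAl -rowE scalerA.
  by rewrite invfM mulrCA divff ?mulr1// gt_eqF// limit_row_gt0.
by rewrite /correction row_mul row_diag_mx mxE index_ofK -scalemxAl -rowE scale1r.
Qed.

Lemma specnorm_correction_gt0 : 0 < specnorm (correction pi).
Proof.
pose i := i0; rewrite lt0r specnorm_ge0 andbT; apply/eqP => D0.
have := specnorm_mulcV (correction pi) (delta_mx i 0); rewrite D0 mul0r.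
rewrite le_eqVlt ltNge l2norm_ge0 orbF l2norm_eq0 => /eqP/colP/(_ i)/eqP.
rewrite mul_diag_mx !mxE !eqxx mulr1 (index_ofK (inl (Ordinal N0))).
by rewrite invr_eq0 mulf_eq0 pnatr_eq0 eqn0Ngt N0/= gt_eqF// (limit_row_gt0 (Ordinal N0)).
Qed.

End Averages.

End Limit.

End ExtendedMatrix.

(** * One iteration, pathwise *)

Section Step.
Context {R : realType} {N d : nat} (e : rel 'I_N) (k : 'I_N -> 'I_N -> nat)
  (W0 : 'M[R]_N) (Winf : 'M[R]_(ext_size e k)) (pi : 'rV[R]_(ext_size e k))
  (f : 'I_N -> 'rV[R]_d -> R) (L : R) (tau : nat) (q : R).
Hypothesis N0 : (0 < N)%N.
Hypothesis eG : gossip_graph e.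
Hypothesis eW : gossip_matrix e W0.
Local Notation W := (ext_matrix e k W0).
Local Notation D := (correction pi).
Local Notation node n := (@index_of N e k (inl n)).
Hypothesis Wcvg : (fun t : nat => W ^+ t) @ \oo --> Winf.
Hypothesis Wpi : forall i j, Winf i j = pi 0 j.
Hypothesis Wq : specnorm (W ^+ tau - Winf) ^+ 2 <= q.
Hypothesis q1 : q < 1.
Hypothesis L0 : 0 <= L.
Hypothesis fL : forall n, smooth L (f n).

Let c : R := 1 - q.
Let favg : 'rV[R]_d -> R := fun x => N%:R^-1 * \sum_n f n x.
Let c0 : 0 < c. Proof. by rewrite subr_gt0. Qed.
Let NR : 0 < N%:R :> R. Proof. by rewrite ltr0n. Qed.

Implicit Types X A : 'M[R]_(ext_size e k, d).

Definition consensus_error X : R := l2norm (X - Winf *m X) ^+ 2.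

Definition virtual_rows0 A := forall v, row (@index_of N e k (inr v)) A = 0.

Lemma consensus_error_eq_rows X :
  (forall i j, row i X = row j X) -> consensus_error X = 0.
Proof.
move=> Xr; rewrite /consensus_error [X in l2norm X](_ : _ = 0) ?l2norm0 ?expr0n//.
apply/row_matrixP => i; rewrite linearB/= (row_Winf_mul Wpi) row0 /weighted_avg.
under eq_bigr do rewrite (Xr _ i).
by rewrite -scaler_suml (limit_row_sum eW Wcvg Wpi N0) scale1r subrr.
Qed.

Lemma sum_row_error_le X :
  \sum_n l2norm (row (node n) X - weighted_avg pi X) ^+ 2 <= consensus_error X.
Proof.
rewrite /consensus_error l2norm_sqr_row sum_nodes.
under [X in _ <= X + _]eq_bigr do rewrite linearB/= (row_Winf_mul Wpi).
by rewrite lerDl sumr_ge0// => v _; rewrite sqr_ge0.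
Qed.

Section OneStep.
Variables (X A : 'M[R]_(ext_size e k, d)) (eta : R).
Hypothesis A0 : virtual_rows0 A.
Let X' := (W ^+ tau) *m (X - eta *: (D *m A)).
Let gbar := N%:R^-1 *: \sum_n row (node n) A.

Lemma step_avg : weighted_avg pi X' = weighted_avg pi X - eta *: gbar.
Proof.
rewrite !weighted_avgE mulmxA (limit_row_pow Wcvg Wpi N0) mulmxBr -scalemxAr.
rewrite (pi_correction eW Wcvg Wpi N0 eG) [\sum_(v : vnode e k) _]big1 ?addr0// => v _.
by rewrite A0 scaler0.
Qed.

Lemma step_consensus : consensus_error X' <=
  (1 - c / 2) * consensus_error X
  + 2 / c * (eta ^+ 2 * specnorm D ^+ 2 * l2norm A ^+ 2).
Proof.
pose E := X - Winf *m X; pose B := eta *: (D *m A).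
(* [W ^+ tau - Winf] annihilates [Winf *m X], so [X] may be replaced by its deviation [E] from
   consensus. *)
have XE : X' - Winf *m X' = (W ^+ tau - Winf) *m (E - B).
  rewrite /X' -/B mulmxA (Winf_mul_pow Wcvg) -mulmxBl /E [in RHS]addrAC.
  rewrite [in RHS]mulmxBr (mulmxA _ Winf) [(_ - _) *m Winf]mulmxBl.
  by rewrite (pow_mul_Winf Wcvg) (Winf_idem Wcvg) subrr mul0mx subr0.
rewrite /consensus_error XE -/E.
apply: (le_trans (specnorm_mul _ _)).
have q0 : 0 <= q by apply: le_trans Wq; rewrite sqr_ge0.
have BD : l2norm B ^+ 2 <= eta ^+ 2 * specnorm D ^+ 2 * l2norm A ^+ 2.
  rewrite /B l2normZ exprMn real_normK ?num_real// -mulrA.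
  by rewrite ler_wpM2l ?sqr_ge0// specnorm_mul.
(* The weight [c / 2] is chosen so that [q = 1 - c] gives [q * (1 + c / 2) <= 1 - c / 2] and
   [q * (1 + 2 / c) <= 2 / c]. *)
have EB : l2norm (E - B) ^+ 2 <= (1 + c / 2) * l2norm E ^+ 2 + (1 + 2 / c) * l2norm B ^+ 2.
  by have := l2normB_sqr_le E B (divr_gt0 c0 (ltr0Sn _ 1)); rewrite invf_div.
apply: (@le_trans _ _ (q * l2norm (E - B) ^+ 2)); first by rewrite ler_wpM2r ?sqr_ge0.
apply: (le_trans (ler_wpM2l q0 EB)).
rewrite mulrDr 2!(mulrA q); apply: lerD.
  rewrite ler_wpM2r ?sqr_ge0// (_ : q = 1 - c); last by rewrite /c; ring.
  by have := sqr_ge0 c; rewrite expr2; lra.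
apply: (@le_trans _ _ (2 / c * l2norm B ^+ 2)).
  rewrite ler_wpM2r ?sqr_ge0// -(ler_pM2r c0).
  have -> : q * (1 + 2 / c) * c = (1 - c) * (c + 2).
    by rewrite (_ : q = 1 - c); [field; rewrite gt_eqF|rewrite /c; ring].
  by rewrite divfK ?gt_eqF//; have := sqr_ge0 c; have := c0; rewrite expr2; lra.
by rewrite ler_pM2l ?divr_gt0.
Qed.

Let x := weighted_avg pi X.
Let h := N%:R^-1 *: \sum_n grad (f n) (row (node n) X).
Let kappa := eta * L ^+ 2 / (N%:R * c).

(* In the Lyapunov function [favg + kappa * consensus_error], the decrease of the
   consensus error pays for the distance between [h] and the gradient at [x]. *)
Lemma step_lyapunov : 0 <= eta -> eta * L <= 1 ->
  eta / 2 * l2norm (grad favg x) ^+ 2 <=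
  (favg x + kappa * consensus_error X)
  - (favg (weighted_avg pi X') + kappa * consensus_error X')
  - eta * mxdot (grad favg x - (eta * L) *: h) (gbar - h)
  + L * eta ^+ 2 / 2 * l2norm (gbar - h) ^+ 2
  + 2 * eta ^+ 3 * L ^+ 2 * specnorm D ^+ 2 / (N%:R * c ^+ 2) * l2norm A ^+ 2.
Proof.
move=> eta0 etaL.
have kappa0 : 0 <= kappa by rewrite /kappa divr_ge0 ?mulr_ge0 ?sqr_ge0 ?(ltW c0).
have := avg_descent fL N0 (weighted_avg pi X) (- (eta *: gbar)).
rewrite -step_avg -/favg -/x -/(favg x) -/(favg (weighted_avg pi X')).
rewrite mxdotNr mxdotZr l2normN l2normZ exprMn real_normK ?num_real// => desc.
have dist := avg_grad_dist fL N0 x (fun n => row (node n) X) L0.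
have LN0 : 0 <= L ^+ 2 / N%:R by rewrite divr_ge0 ?sqr_ge0.
have := le_trans dist (ler_wpM2l LN0 (sum_row_error_le X)).
rewrite -/favg -/h -/x => {}dist.
have := ler_wpM2l kappa0 step_consensus.
set gf := grad favg x in desc dist *; set eps := gbar - h.
have gE : gbar = h + eps by rewrite /eps addrCA subrr addr0.
clearbody eps.
rewrite gE in desc.
rewrite (l2norm_sqr (h + eps)) mxdotDl !mxdotDr (mxdotC eps h) -!l2norm_sqr in desc.
rewrite (l2norm_sqr (gf - h)) mxdotBl !mxdotBr (mxdotC h gf) -!l2norm_sqr in dist.
(* Expanding the descent inequality at [gbar = h + eps] produces [- eta * mxdot gf eps] and
   [L * eta ^+ 2 * mxdot h eps]; together they form the noise term of the statement. *)
rewrite mxdotBl mxdotZl.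
set a := mxdot gf h in desc dist *; set b := mxdot gf eps in desc *.
set h2 := l2norm h ^+ 2 in desc dist *.
set he := mxdot h eps in desc *; set e2 := l2norm eps ^+ 2 in desc *.
set F' := favg (weighted_avg pi X') in desc *.
set g2 := l2norm gf ^+ 2 in dist *.
set CE := consensus_error X in dist *; set CE' := consensus_error X'.
set A2 := l2norm A ^+ 2; set DD := specnorm D ^+ 2.
(* [kappa] is the value with [kappa * c / 2 = eta / 2 * (L ^+ 2 / N)]: the decrease of the consensus
   error cancels the bound on the distance between [gf] and [h] exactly. *)
have -> : kappa * ((1 - c / 2) * CE + 2 / c * (eta ^+ 2 * DD * A2)) =
  kappa * CE - eta / 2 * (L ^+ 2 / N%:R * CE)
  + 2 * eta ^+ 3 * L ^+ 2 * DD / (N%:R * c ^+ 2) * A2.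
  by rewrite /kappa; field; rewrite !gt_eqF.
have d2 := ler_wpM2l (divr_ge0 eta0 (ler0n _ 2)) dist.
have h20 : 0 <= h2 by rewrite sqr_ge0.
have etaL' : 0 <= 1 - eta * L by rewrite subr_ge0.
have := mulr_ge0 (mulr_ge0 eta0 etaL') h20.
lra.
Qed.

End OneStep.

End Step.

(** * Expectations along the iterations *)

Section RealExpectation.
Context {R : realType} {dO} {Omega : measurableType dO} (P : probability Omega R).
Implicit Types h : Omega -> R.

Definition integ h : Prop := P.-integrable [set: Omega] (EFin \o h).
(** A real-valued expectation, on which linear arithmetic works directly; it represents the extended
    integral when [integ h] holds. *)
Definition Ex h : R := \int[P]_w h w.

Lemma Ex_EFin h : integ h -> (\int[P]_w (h w)%:E)%E = (Ex h)%:E.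
Proof. by move=> ih; rewrite /Ex /Rintegral fineK//; exact: integrable_fin_num ih. Qed.

Lemma Ex_le_of_ereal h (B : R) : integ h -> (\int[P]_w (h w)%:E <= B%:E)%E -> Ex h <= B.
Proof. by move=> ih; rewrite Ex_EFin// lee_fin. Qed.

Lemma integ_cst (a : R) : integ (cst a).
Proof. exact: finite_measure_integrable_cst. Qed.

Lemma Ex_cst (a : R) : Ex (cst a) = a.
Proof. by rewrite /Ex /Rintegral; have := expectation_cst P a; rewrite unlock => /= ->. Qed.

Lemma integD h1 h2 : integ h1 -> integ h2 -> integ (fun w => h1 w + h2 w).
Proof. by move=> i1 i2; have := integrableD measurableT i1 i2. Qed.

Lemma ExD h1 h2 : integ h1 -> integ h2 -> Ex (fun w => h1 w + h2 w) = Ex h1 + Ex h2.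
Proof. by move=> i1 i2; exact: RintegralD. Qed.

Lemma integZ (a : R) h : integ h -> integ (fun w => a * h w).
Proof. by move=> ih; have := integrableZl measurableT a ih. Qed.

Lemma ExZ (a : R) h : integ h -> Ex (fun w => a * h w) = a * Ex h.
Proof. by move=> ih; exact: RintegralZl. Qed.

Lemma integ_sum (I : Type) (r : seq I) (F : I -> Omega -> R) :
  (forall i, integ (F i)) -> integ (fun w => \sum_(i <- r) F i w).
Proof.
move=> iF; elim: r => [|i r IHr].
  by have := integ_cst 0; congr integ; apply/funext => w; rewrite big_nil.
by have := integD (iF i) IHr; congr integ; apply/funext => w; rewrite big_cons.
Qed.

Lemma Ex_sum (I : Type) (r : seq I) (F : I -> Omega -> R) :
  (forall i, integ (F i)) -> Ex (fun w => \sum_(i <- r) F i w) = \sum_(i <- r) Ex (F i).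
Proof.
move=> iF; elim: r => [|i r IHr].
  rewrite big_nil -[RHS](Ex_cst 0); congr Ex; apply/funext => w; exact: big_nil.
rewrite big_cons -IHr -ExD//; last exact: integ_sum.
by congr Ex; apply/funext => w; rewrite big_cons.
Qed.

Lemma Ex_le h1 h2 : integ h1 -> integ h2 -> (forall w, h1 w <= h2 w) -> Ex h1 <= Ex h2.
Proof. by move=> i1 i2 h12; apply: le_Rintegral => // w _; exact: h12. Qed.

End RealExpectation.

(** * Measurability of the iterates *)

Section Iterates.
Context {R : realType} {N d : nat} (e : rel 'I_N) (k : 'I_N -> 'I_N -> nat)
  (dS : measure_display) (S : 'I_N -> measurableType dS)
  (gF : forall n, 'rV[R]_d -> S n -> 'rV[R]_d).
Local Notation node n := (@index_of N e k (inl n)).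

Lemma row_stoch_grads (X : 'M[R]_(ext_size e k, d)) (z : forall n, S n) n :
  row (node n) (stoch_grads gF X z) = @gF n (row (node n) X) (z n).
Proof. by apply/rowP => j; rewrite !mxE index_ofK. Qed.

Lemma virtual_stoch_grads (X : 'M[R]_(ext_size e k, d)) (z : forall n, S n) :
  virtual_rows0 (stoch_grads gF X z).
Proof. by move=> v; apply/rowP => j; rewrite !mxE index_ofK mxE. Qed.

Hypothesis mgF : forall n, jointly_measurable (@gF n).

(** The iterate at time [t] uses only samples drawn before [t]. The measurable space is arbitrary so
    that the lemma serves both for the full sigma-algebra and for the one generated by all samples
    but one. *)
Lemma mvec_dtgo dT (T : measurableType dT) (z : T -> nat -> forall n, S n)
    (Wg : 'M[R]_(ext_size e k)) (pi : 'rV[R]_(ext_size e k)) tau eta X0 t :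
  (forall s n, (s < t)%N -> measurable_fun [set: T] (fun w => z w s n)) ->
  forall i, mvec (fun w => row i (dtgo gF Wg (correction pi) tau eta X0 (z w) t)).
Proof.
elim: t => [|t IHt] mz i /=; first exact: mvec_cst.
under eq_fun do rewrite row_mul mulmx_sum_row.
apply: mvec_sum => j; apply: mvecZ.
under eq_fun do rewrite linearB linearZ /= row_mul row_diag_mx -scalemxAl -rowE.
have mX l := IHt (fun s n st => mz s n (ltnW st)) l.
apply: mvecB => //; apply: mvecZ; apply: mvecZ.
rewrite -(node_ofK j); case: (node_of j) => [n|v].
  under eq_fun do rewrite row_stoch_grads.
  by apply: measurable_joint => //; exact: mz.
under eq_fun do rewrite virtual_stoch_grads.
exact: mvec_cst.
Qed.

End Iterates.

(** * Moments and orthogonality of the gradient noise along the trajectory *)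

Section Noise.
Context {R : realType} {N d : nat} (e : rel 'I_N) (k : 'I_N -> 'I_N -> nat)
  (Wg : 'M[R]_(ext_size e k)) (pi : 'rV[R]_(ext_size e k)) (tau : nat) (eta : R)
  (f : 'I_N -> 'rV[R]_d -> R) (G : R) (sigma : 'I_N -> R)
  (dO dS : measure_display) (Omega : measurableType dO)
  (P : probability Omega R) (S : 'I_N -> measurableType dS)
  (xi : forall (t : nat) (n : 'I_N), Omega -> S n)
  (gF : forall n : 'I_N, 'rV[R]_d -> S n -> 'rV[R]_d)
  (X0 : 'M[R]_(ext_size e k, d)).
Hypothesis N0 : (0 < N)%N.
Hypothesis mgF : forall n, jointly_measurable (@gF n).
Hypothesis xi_indep : mutually_independent P (S := fun i : nat * 'I_N => S i.2)
    (fun i => xi i.1 i.2).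
Hypothesis unbiased : forall t n x j,
     ('E_P[(fun w => @gF n x (xi t n w) 0 j)%R] = (grad (f n) x 0 j)%R%:E)%E.
Hypothesis variance : forall t n x,
     ('E_P[(fun w => l2norm (@gF n x (xi t n w) - grad (f n) x) ^+ 2)%R]
       <= (sigma n ^+ 2)%R%:E)%E.
Hypothesis second_moment : forall t n x,
     ('E_P[(fun w => l2norm (@gF n x (xi t n w)) ^+ 2)%R] <= (G ^+ 2)%R%:E)%E.

Local Notation node n := (@index_of N e k (inl n)).

Definition iterate (t : nat) (w : Omega) :=
  dtgo gF Wg (correction pi) tau eta X0 (fun s n => xi s n w) t.
Local Notation X := iterate.

Definition gradients (t : nat) (w : Omega) := stoch_grads gF (X t w) (fun n => xi t n w).

Definition noise t n w :=
  @gF n (row (node n) (X t w)) (xi t n w) - grad (f n) (row (node n) (X t w)).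

Local Notation off t n := (g_sigma_algebraType
  (@cylinders_off _ _ Omega (nat * 'I_N)%type (fun i => S i.2) (fun i => xi i.1 i.2) (t, n))
  : measurableType _).

Let mxi t n : measurable_fun [set: Omega] (xi t n).
Proof. exact: (xi_indep.1 (t, n)). Qed.

Let mxi_off s m t n : (s, m) != (t, n) ->
  measurable_fun [set: off t n] (xi s m).
Proof. exact: (@measurable_off _ _ Omega (nat * 'I_N)%type (fun i => S i.2) (fun i => xi i.1 i.2) (t, n) (s, m)). Qed.

Let moff t n := cylinders_off_measurable (i0 := (t, n)) xi_indep.
Let ioff t n := sigma_off_indep (i0 := (t, n)) xi_indep.

Let mX_off t n i : mvec (fun w : off t n => row i (X t w)).
Proof.
apply: (mvec_dtgo (T := off t n) mgF (z := fun w s m => xi s m w)) => s m st.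
by apply: mxi_off; rewrite xpair_eqE (ltn_eqF st).
Qed.

Let mX t i : mvec (fun w => row i (X t w)).
Proof. exact: (mvec_dtgo mgF (z := fun w s m => xi s m w)). Qed.

Lemma mvec_grad dT (T : measurableType dT) (x : T -> 'rV[R]_d) n :
  mvec x -> mvec (fun w => grad (f n) (x w)).
Proof. exact: (measurable_mean (m := grad (f n)) (@mgF n) (@mxi 0%N n) (@unbiased 0%N n)). Qed.

Let var_int t n x :
  (\int[P]_w (l2norm (@gF n x (xi t n w) - grad (f n) x) ^+ 2)%:E <= (sigma n ^+ 2)%:E)%E.
Proof. by have := variance t n x; rewrite unlock. Qed.

Let mom_int t n x :
  (\int[P]_w (l2norm (@gF n x (xi t n w)) ^+ 2)%:E <= (G ^+ 2)%:E)%E.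
Proof. by have := second_moment t n x; rewrite unlock. Qed.

Section FixedTime.
Variable t : nat.

Section Sample.
Variable n : 'I_N.
Variable x : Omega -> 'rV[R]_d.
Hypothesis mx : mvec (x : off t n -> 'rV[R]_d).

Let mx' : mvec x. Proof. exact: (mvec_sub_sigma (@moff t n) mx). Qed.

Let sqint_sample : sqint P (fun w => @gF n (x w) (xi t n w)).
Proof.
apply: (@sqint_le _ _ _ _ _ _ (G ^+ 2)); first exact: measurable_joint.
exact: (grad_second_moment (@moff t n) (@mxi t n) (@ioff t n) (@mgF n) mx (@mom_int t n)).
Qed.

Let noise_le :=
  noise_second_moment (@moff t n) (@mxi t n) (@ioff t n) (@mgF n) (@unbiased t n) mx (@var_int t n).

Let sqint_sample_noise : sqint P (fun w => @gF n (x w) (xi t n w) - grad (f n) (x w)).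
Proof.
apply: (@sqint_le _ _ _ _ _ _ (sigma n ^+ 2)); last exact: noise_le.
by apply: mvecB; [exact: measurable_joint|exact: mvec_grad].
Qed.

(** The gradient is the stochastic gradient minus its noise, and both are square-integrable. *)
Lemma sqint_grad : sqint P (fun w => grad (f n) (x w)).
Proof.
have := sqintB sqint_sample sqint_sample_noise.
by congr sqint; apply/funext => w; rewrite subKr.
Qed.

End Sample.

Lemma sqint_noise n : sqint P (noise t n).
Proof.
apply: (@sqint_le _ _ _ _ _ _ (sigma n ^+ 2)).
  by apply: mvecB; [exact: measurable_joint|exact: mvec_grad].
exact: (noise_second_moment (@moff t n) (@mxi t n) (@ioff t n) (@mgF n) (@unbiased t n)
  (@mX_off t n _) (@var_int t n)).
Qed.

Lemma Ex_noise_sqr n : Ex P (fun w => l2norm (noise t n w) ^+ 2) <= sigma n ^+ 2.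
Proof.
apply: Ex_le_of_ereal; first by case: (sqint_noise n).
exact: (noise_second_moment (@moff t n) (@mxi t n) (@ioff t n) (@mgF n) (@unbiased t n)
  (@mX_off t n _) (@var_int t n)).
Qed.

Lemma Ex_noise_orthogonal n (v : Omega -> 'rV[R]_d) :
  mvec (v : off t n -> 'rV[R]_d) -> sqint P v ->
  Ex P (fun w => mxdot (v w) (noise t n w)) = 0.
Proof.
move=> mv sv; rewrite /Ex /Rintegral.
by rewrite (noise_orthogonal (@moff t n) (@mxi t n) (@ioff t n) (@mgF n) (@unbiased t n)
  (@mX_off t n _) (@var_int t n) mv sv).
Qed.

(** From the viewpoint of node [n], the noise of another node at the same time counts as past;
    orthogonality to the past then makes the two noises uncorrelated. *)
Lemma mvec_noise_off n m : m != n -> mvec (noise t m : off t n -> 'rV[R]_d).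
Proof.
move=> mn; apply: mvecB; last exact: mvec_grad.
by apply: measurable_joint => //; apply: mxi_off; rewrite xpair_eqE negb_and mn orbT.
Qed.

Definition mean_noise w := N%:R^-1 *: \sum_n noise t n w.

Lemma sqint_mean_noise : sqint P mean_noise.
Proof. by apply: sqintZ; apply: sqint_sum => n; exact: sqint_noise. Qed.

(** The cross terms of the expanded square vanish, which is the source of the factor [1 / N] in the
    variance term of the rate. *)
Lemma Ex_mean_noise_sqr :
  Ex P (fun w => l2norm (mean_noise w) ^+ 2) <= N%:R^-1 * \sum_n sigma n ^+ 2 / N%:R.
Proof.
have NR : 0 < N%:R :> R by rewrite ltr0n.
have ie n m : integ P (fun w => mxdot (noise t n w) (noise t m w)).
  exact: integrable_mxdot (sqint_noise n) (sqint_noise m).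
have -> : (fun w => l2norm (mean_noise w) ^+ 2) = (fun w =>
    N%:R^-1 ^+ 2 * \sum_n \sum_m mxdot (noise t n w) (noise t m w)).
  apply/funext => w; rewrite /mean_noise l2normZ exprMn real_normK ?num_real//.
  rewrite l2norm_sqr mxdot_suml; congr (_ * _).
  by apply: eq_bigr => n _; rewrite mxdot_sumr.
rewrite ExZ; last by apply: integ_sum => n; exact: integ_sum.
rewrite Ex_sum; last by move=> n; exact: integ_sum.
rewrite expr2 -!mulrA ler_pM2l ?invr_gt0// mulr_sumr; apply: ler_sum => n _.
rewrite mulrC ler_pM2r ?invr_gt0// Ex_sum// (bigD1 n)//= big1 ?addr0.
  by under eq_fun do rewrite -l2norm_sqr; exact: Ex_noise_sqr.
move=> m mn; under eq_fun do rewrite mxdotC.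
by apply: Ex_noise_orthogonal; [exact: mvec_noise_off|exact: sqint_noise].
Qed.

Lemma mean_noiseE w : N%:R^-1 *: \sum_n row (node n) (gradients t w) -
  N%:R^-1 *: \sum_n grad (f n) (row (node n) (X t w)) = mean_noise w.
Proof.
rewrite -scalerBr -sumrB; congr (_ *: _); apply: eq_bigr => n _.
by rewrite row_stoch_grads.
Qed.

Lemma l2norm_gradients w : l2norm (gradients t w) ^+ 2 =
  \sum_n l2norm (@gF n (row (node n) (X t w)) (xi t n w)) ^+ 2.
Proof.
rewrite l2norm_sqr_row sum_nodes [X in _ + X]big1 ?addr0 => [|v _]; last first.
  by rewrite virtual_stoch_grads l2norm0 expr0n.
by apply: eq_bigr => n _; rewrite row_stoch_grads.
Qed.

Lemma integ_gradients_row n :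
  integ P (fun w => l2norm (@gF n (row (node n) (X t w)) (xi t n w)) ^+ 2).
Proof.
have [] // : sqint P (fun w => @gF n (row (node n) (X t w)) (xi t n w)).
apply: (@sqint_le _ _ _ _ _ _ (G ^+ 2)); first exact: measurable_joint.
exact: (grad_second_moment (@moff t n) (@mxi t n) (@ioff t n) (@mgF n) (@mX_off t n _) (@mom_int t n)).
Qed.

Lemma integ_gradients : integ P (fun w => l2norm (gradients t w) ^+ 2).
Proof.
by under eq_fun do rewrite l2norm_gradients; apply: integ_sum; exact: integ_gradients_row.
Qed.

Lemma Ex_gradients : Ex P (fun w => l2norm (gradients t w) ^+ 2) <= N%:R * G ^+ 2.
Proof.
under eq_fun do rewrite l2norm_gradients.
rewrite Ex_sum; last exact: integ_gradients_row.
rewrite mulr_natl -[X in _ *+ X]card_ord -sumr_const; apply: ler_sum => n _.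
apply: Ex_le_of_ereal; first exact: integ_gradients_row.
exact: (grad_second_moment (@moff t n) (@mxi t n) (@ioff t n) (@mgF n) (@mX_off t n _) (@mom_int t n)).
Qed.

Lemma mvec_weighted_avg dT (T : measurableType dT) (Y : T -> 'M[R]_(ext_size e k, d)) :
  (forall i, mvec (fun w => row i (Y w))) -> mvec (fun w => weighted_avg pi (Y w)).
Proof. by move=> mY; apply: mvec_sum => i; exact: mvecZ. Qed.

Lemma sqint_grad_avg :
  sqint P (fun w => N%:R^-1 *: \sum_n grad (f n) (weighted_avg pi (X t w))).
Proof.
apply: sqintZ; apply: sqint_sum => n; apply: sqint_grad.
exact: (mvec_weighted_avg (T := off t n) (@mX_off t n)).
Qed.

(** For [a = eta * L] this is the vector paired with the mean noise in [step_lyapunov]; it depends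
    on samples before time [t] only. *)
Let drift (a : R) w := N%:R^-1 *: \sum_n grad (f n) (weighted_avg pi (X t w)) -
     a *: (N%:R^-1 *: \sum_n grad (f n) (row (node n) (X t w))).

Lemma sqint_drift a : sqint P (drift a).
Proof.
apply: sqintB; first exact: sqint_grad_avg.
by do 2!apply: sqintZ; apply: sqint_sum => n; apply: sqint_grad; exact: mX_off.
Qed.

Lemma Ex_mean_noise_orthogonal a :
  Ex P (fun w => mxdot (drift a w) (mean_noise w)) = 0.
Proof.
have mv n : mvec (drift a : off t n -> _).
  apply: mvecB; do ?apply: mvecZ; apply: mvec_sum => m; apply: mvec_grad.
    exact: (mvec_weighted_avg (T := off t n) (@mX_off t n)).
  exact: mX_off.
under eq_fun do rewrite /mean_noise mxdotZr mxdot_sumr.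
have iv n : integ P (fun w => mxdot (drift a w) (noise t n w)).
  exact: integrable_mxdot (sqint_drift a) (sqint_noise n).
rewrite ExZ; last exact: integ_sum.
rewrite Ex_sum// big1 ?mulr0// => n _.
by apply: Ex_noise_orthogonal; [exact: mv|exact: sqint_drift].
Qed.

End FixedTime.

(** Jensen's inequality for the mean of a stochastic gradient at a fixed point. It makes all
    gradients vanish when [G = 0]. *)
Lemma l2norm_grad_le n x : l2norm (grad (f n) x) ^+ 2 <= G ^+ 2.
Proof.
have mc : mvec (fun w : off 0%N n => x) by exact: mvec_cst.
have snoise : sqint P (fun w => @gF n x (xi 0%N n w) - grad (f n) x).
  apply: (sqint_le _ (var_int 0 n x)); apply: mvecB; last exact: mvec_cst.
  by apply: measurable_joint => //; exact: mvec_cst.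
have scst (c : 'rV[R]_d) : sqint P (fun=> c).
  exact: (sqint_bounded P (mvec_cst c) (fun=> lexx _)).
have ssample : sqint P (fun w => @gF n x (xi 0%N n w)).
  by have := sqintD snoise (scst (grad (f n) x)); congr sqint; apply/funext => w; rewrite subrK.
have isample : integ P (fun w => l2norm (@gF n x (xi 0%N n w)) ^+ 2) by case: ssample.
apply: le_trans (Ex_le_of_ereal isample (mom_int 0 n x)).
have idot : integ P (fun w => mxdot (grad (f n) x) (@gF n x (xi 0%N n w) - grad (f n) x)).
  exact: integrable_mxdot (scst _) snoise.
(* The tangent bound of the squared norm at the gradient: its linear term pairs a constant with
   centred noise and has mean zero. *)
apply: (@le_trans _ _ (Ex P (fun w => l2norm (grad (f n) x) ^+ 2 +
  2 * mxdot (grad (f n) x) (@gF n x (xi 0%N n w) - grad (f n) x)))).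
  rewrite ExD; [|exact: integ_cst|exact: integZ].
  rewrite Ex_cst ExZ// /Ex /Rintegral.
  rewrite (noise_orthogonal (@moff 0%N n) (@mxi 0%N n) (@ioff 0%N n) (@mgF n) (@unbiased 0%N n)
    mc (@var_int 0%N n) (mvec_cst _) (scst _)) /= mulr0 addr0//.
apply: Ex_le => //; first by apply: integD; [exact: integ_cst|exact: integZ].
move=> w; set a := grad _ _; set b := @gF n _ _.
rewrite mxdotBr -!l2norm_sqr.
have := mxdot_young a b; have := sqr_ge0 (l2norm (b - a)).
rewrite !l2norm_sqr mxdotBl !mxdotBr (mxdotC b a); lra.
Qed.

End Noise.

(** * Choice of the stepsize *)

Section Stepsize.
Context {R : realType}.

(* Here [s + u^2 + v] is the announced rate. With [eta = F0 / (T Q)] the term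
   [2 F0 / (eta T)] is exactly [2 Q], and [s, u^2, v <= Q] bounds the other ones, so that
   no case distinction on a zero variance is needed. *)
Lemma stepsize_bound (F0 L sN B2 a T s u v Sg Q eta : R) :
  0 < F0 -> 0 < L -> 0 < T -> 0 <= s -> 0 < u -> 0 <= sN ->
  s ^+ 2 = L * F0 * sN / T ->
  u ^+ 6 = (B2 * F0 / T) ^+ 2 ->
  v = L * F0 / T ->
  a / T <= u ^+ 2 ->
  Q = s + u ^+ 2 + v ->
  eta = F0 / (T * Q) ->
  [/\ 0 < eta, eta * L <= 1 &
   (eta / 2 * Sg <= F0 + eta / 2 * a + T * (L * eta ^+ 2 / 2 * sN + 2 * eta ^+ 3 * B2 ^+ 2) ->
    T^-1 * Sg <= 7 * Q)].
Proof.
move=> F00 L0 T0 s0 u0 sN0 sE uE vE aT QE etaE.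
have v0 : 0 < v by rewrite vE divr_gt0// mulr_gt0.
have u20 : 0 < u ^+ 2 by rewrite exprn_gt0.
have Q0 : 0 < Q by rewrite QE; lra.
have eta0 : 0 < eta by rewrite etaE divr_gt0// mulr_gt0.
have etaL : eta * L = v / Q.
  by rewrite etaE vE; field; rewrite !gt_eqF.
split => //; first by rewrite etaL ler_pdivrMr// mul1r QE; lra.
move=> h.
(* The hypothesis is divided by [eta * T / 2]; since [F0 = eta * T * Q], the leading term becomes
   [2 * Q]. *)
have h2 : T^-1 * Sg <= 2 * Q + a / T + eta * L * sN + 4 * eta ^+ 2 * B2 ^+ 2.
  rewrite -(ler_pM2l (divr_gt0 (mulr_gt0 eta0 T0) (ltr0Sn R 1))).
  have -> : eta * T / 2 * (T^-1 * Sg) = eta / 2 * Sg by field; rewrite gt_eqF.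
  apply: (le_trans h); rewrite le_eqVlt; apply/orP; left; apply/eqP.
  have -> : F0 = eta * T * Q by rewrite etaE; field; rewrite !gt_eqF.
  by field; rewrite gt_eqF.
have h3 : eta * L * sN <= s.
  have -> : eta * L * sN = s ^+ 2 / Q by rewrite sE etaE; field; rewrite !gt_eqF.
  by rewrite ler_pdivrMr// expr2 ler_wpM2l// QE; lra.
have h4 : eta ^+ 2 * B2 ^+ 2 <= u ^+ 2.
  have -> : eta ^+ 2 * B2 ^+ 2 = u ^+ 6 / Q ^+ 2.
    by rewrite uE etaE; field; rewrite !gt_eqF.
  rewrite ler_pdivrMr ?exprn_gt0// (_ : u ^+ 6 = u ^+ 2 * (u ^+ 2) ^+ 2); last by ring.
  by rewrite ler_pM2l// lerXn2r ?nnegrE ?ltW// QE; lra.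
(* The constant 7 arises here: [2 * Q + u ^+ 2 + s + 4 * u ^+ 2 <= 7 * Q]. *)
lra.
Qed.

Lemma powR_half_sqr (x : R) : 0 <= x -> (x `^ (1 / 2)) ^+ 2 = x.
Proof.
move=> x0; rewrite -powR_mulrn ?powR_ge0// -powRrM.
by rewrite (_ : 1 / 2 * 2%:R = 1) ?powRr1//; field.
Qed.

Lemma powR_third_cube (x : R) : 0 <= x -> (x `^ (1 / 3)) ^+ 3 = x.
Proof.
move=> x0; rewrite -powR_mulrn ?powR_ge0// -powRrM.
by rewrite (_ : 1 / 3 * 3%:R = 1) ?powRr1//; field.
Qed.

Lemma powR_third_sqr (x : R) : (x `^ (1 / 3)) ^+ 2 = x `^ (2 / 3).
Proof.
rewrite -powR_mulrn ?powR_ge0// -powRrM.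
by rewrite (_ : 1 / 3 * 2%:R = 2 / 3)//; field.
Qed.

(* The hypothesis on [T] is what determines the [T0] of the theorem. *)
Lemma transient_le (a M T u : R) : 0 <= a -> 0 < M -> 0 < T -> 0 < u ->
  u ^+ 3 = M / T -> a ^+ 3 / M ^+ 2 <= T -> a / T <= u ^+ 2.
Proof.
move=> a0 M0 T0 u0 uE aT.
have aT0 : 0 <= a / T by rewrite divr_ge0// ltW.
(* Cubing both sides makes [u] appear only through [u ^+ 3], which is known. *)
rewrite -(@ler_pXn2r _ 3%N) ?nnegrE ?sqr_ge0//.
have -> : (u ^+ 2) ^+ 3 = (u ^+ 3) ^+ 2 by ring.
rewrite uE !exprMn !exprVn.
rewrite ler_pdivrMr ?exprn_gt0//.
have -> : M ^+ 2 / T ^+ 2 * T ^+ 3 = T * M ^+ 2 by field; rewrite gt_eqF.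
by rewrite -ler_pdivrMr ?exprn_gt0.
Qed.

End Stepsize.

(** * Summation of the pathwise inequality and passage to expectations *)

Section ExpectedDescent.
Context {R : realType} {N d : nat} (e : rel 'I_N) (k : 'I_N -> 'I_N -> nat)
  (W0 : 'M[R]_N) (Winf : 'M[R]_(ext_size e k)) (pi : 'rV[R]_(ext_size e k))
  (tau : nat) (eta q : R) (f : 'I_N -> 'rV[R]_d -> R) (fstar L G : R) (sigma : 'I_N -> R)
  (dO dS : measure_display) (Omega : measurableType dO)
  (P : probability Omega R) (S : 'I_N -> measurableType dS)
  (xi : forall (t : nat) (n : 'I_N), Omega -> S n)
  (gF : forall n : 'I_N, 'rV[R]_d -> S n -> 'rV[R]_d)
  (X0 : 'M[R]_(ext_size e k, d)).
Local Notation W := (ext_matrix e k W0).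
Local Notation D := (correction pi).
Local Notation node n := (@index_of N e k (inl n)).
Let c : R := 1 - q.
Let favg : 'rV[R]_d -> R := fun x => N%:R^-1 * \sum_n f n x.

Hypothesis N0 : (0 < N)%N.
Hypothesis eG : gossip_graph e.
Hypothesis eW : gossip_matrix e W0.
Hypothesis Wcvg : (fun t : nat => W ^+ t) @ \oo --> Winf.
Hypothesis Wpi : forall i j, Winf i j = pi 0 j.
Hypothesis Wq : specnorm (W ^+ tau - Winf) ^+ 2 <= q.
Hypothesis q1 : q < 1.
Hypothesis L0 : 0 <= L.
Hypothesis fL : forall n, smooth L (f n).
Hypothesis fstar_le : forall x, fstar <= favg x.
Hypothesis mgF : forall n, jointly_measurable (@gF n).
Hypothesis xi_indep : mutually_independent P (S := fun i : nat * 'I_N => S i.2)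
    (fun i => xi i.1 i.2).
Hypothesis unbiased : forall t n x j,
     ('E_P[(fun w => @gF n x (xi t n w) 0 j)%R] = (grad (f n) x 0 j)%R%:E)%E.
Hypothesis variance : forall t n x,
     ('E_P[(fun w => l2norm (@gF n x (xi t n w) - grad (f n) x) ^+ 2)%R]
       <= (sigma n ^+ 2)%R%:E)%E.
Hypothesis second_moment : forall t n x,
     ('E_P[(fun w => l2norm (@gF n x (xi t n w)) ^+ 2)%R] <= (G ^+ 2)%R%:E)%E.

Local Notation X := (iterate W pi tau eta xi gF X0).

Let grad_favg x : grad favg x = N%:R^-1 *: \sum_n grad (f n) x.
Proof. exact: (grad_avg fL). Qed.

Lemma integ_grad_favg t :
  integ P (fun w => l2norm (grad favg (weighted_avg pi (X t w))) ^+ 2).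
Proof.
under eq_fun do rewrite grad_favg.
by have [] := sqint_grad_avg W pi tau eta X0 mgF xi_indep unbiased variance second_moment t.
Qed.

Hypothesis eta0 : 0 <= eta.
Hypothesis etaL : eta * L <= 1.

Let b2 : R := 2 * eta ^+ 3 * L ^+ 2 * specnorm D ^+ 2 / (N%:R * c ^+ 2).

Let M := mean_noise W pi tau eta f xi gF X0.
Let A := gradients W pi tau eta xi gF X0.
Let h t w : 'rV[R]_d := N%:R^-1 *: \sum_n grad (f n) (row (node n) (X t w)).
Let v t w : 'rV[R]_d := N%:R^-1 *: \sum_n grad (f n) (weighted_avg pi (X t w)) -
  (eta * L) *: h t w.
(** The part of the one-step inequality that does not telescope: a term of mean zero, the mean
    noise, and the size of the stochastic gradients. *)
Let r t w : R := (- eta) * mxdot (v t w) (M t w)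
  + (L * eta ^+ 2 / 2 * l2norm (M t w) ^+ 2 + b2 * l2norm (A t w) ^+ 2).
Let kappa : R := eta * L ^+ 2 / (N%:R * c).
Let V t w : R := favg (weighted_avg pi (X t w)) + kappa * consensus_error Winf (X t w).

Let c0 : 0 < c. Proof. by rewrite subr_gt0. Qed.
Let NR : 0 < N%:R :> R. Proof. by rewrite ltr0n. Qed.
Let b20 : 0 <= b2.
Proof. by rewrite /b2 divr_ge0 ?mulr_ge0 ?exprn_ge0 ?specnorm_ge0 ?(ltW c0). Qed.

Let pathwise_step t w :
  eta / 2 * l2norm (grad favg (weighted_avg pi (X t w))) ^+ 2 <= V t w - V t.+1 w + r t w.
Proof.
have A0 : virtual_rows0 (A t w) by exact: virtual_stoch_grads.
have := step_lyapunov N0 eG eW Wcvg Wpi Wq q1 L0 fL (X t w) A0 eta0 etaL.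
rewrite -/favg (mean_noiseE W pi tau eta f xi gF X0 t w) -/(M t w).
rewrite [in mxdot _ _]grad_favg -/(h t w) -/(v t w).
by rewrite -/c -/b2 -/kappa /V /r /A /= mulNr !addrA.
Qed.

(** After telescoping, [V 0] is deterministic and [V T] is at least [fstar]. Only constants and the
    remainders are left, so the objective and the consensus error never have to be integrated. *)
Let pathwise_sum T w :
  eta / 2 * \sum_(0 <= t < T) l2norm (grad favg (weighted_avg pi (X t w))) ^+ 2 <=
  favg (weighted_avg pi X0) - fstar + kappa * consensus_error Winf X0
  + \sum_(0 <= t < T) r t w.
Proof.
rewrite mulr_sumr.
apply: (@le_trans _ _ (\sum_(0 <= t < T) (V t w - V t.+1 w + r t w))).
  by apply: ler_sum => t _; exact: pathwise_step.
rewrite big_split /= lerD2r (@telescope_sumr_eq _ 0 T (fun t => - V t w))//; last first.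
  by move=> t _; rewrite opprK addrC.
have kappa0 : 0 <= kappa by rewrite /kappa divr_ge0 ?mulr_ge0 ?sqr_ge0 ?(ltW c0).
have VT : fstar <= V T w.
  rewrite (le_trans (fstar_le (weighted_avg pi (X T w))))// /V lerDl.
  by apply: mulr_ge0 => //; rewrite /consensus_error sqr_ge0.
have V0 : V 0%N w = favg (weighted_avg pi X0) + kappa * consensus_error Winf X0 by [].
lra.
Qed.

Let integ_terms t : [/\ integ P (fun w => mxdot (v t w) (M t w)),
  integ P (fun w => l2norm (M t w) ^+ 2) & integ P (fun w => l2norm (A t w) ^+ 2)].
Proof.
have sM : sqint P (M t) by exact: (sqint_mean_noise _ _ _ _ _ mgF xi_indep unbiased variance).
split; [|by case: sM|exact: (integ_gradients _ _ _ _ _ mgF xi_indep second_moment)].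
apply: integrable_mxdot sM.
exact: (sqint_drift W pi tau eta X0 mgF xi_indep unbiased variance second_moment).
Qed.

Let integ_r t : integ P (r t).
Proof.
have [i1 i2 i3] := integ_terms t.
by apply: integD; [exact: integZ|apply: integD; exact: integZ].
Qed.

Let Ex_r t : Ex P (r t) <=
  L * eta ^+ 2 / 2 * (N%:R^-1 * \sum_n sigma n ^+ 2 / N%:R) + b2 * (N%:R * G ^+ 2).
Proof.
have [i1 i2 i3] := integ_terms t.
rewrite /r ExD; [|exact: integZ|by apply: integD; exact: integZ].
rewrite ExD; [|exact: integZ|exact: integZ].
rewrite !ExZ// (Ex_mean_noise_orthogonal W pi tau eta X0 mgF xi_indep unbiased variance
  second_moment) mulr0 add0r.
apply: lerD; apply: ler_wpM2l => //.
- by rewrite divr_ge0// mulr_ge0// sqr_ge0.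
- exact: (Ex_mean_noise_sqr _ _ _ _ _ N0 mgF xi_indep unbiased variance).
- exact: (Ex_gradients _ _ _ _ _ mgF xi_indep second_moment).
Qed.

Lemma expected_gradient_sum T :
  eta / 2 * \sum_(0 <= t < T) Ex P (fun w => l2norm (grad favg (weighted_avg pi (X t w))) ^+ 2) <=
  (favg (weighted_avg pi X0) - fstar)
  + eta / 2 * (2 * L ^+ 2 * consensus_error Winf X0 / (N%:R * c))
  + T%:R * (L * eta ^+ 2 / 2 * ((N%:R^-1 * \sum_n sigma n ^+ 2) / N%:R)
     + 2 * eta ^+ 3 * (L * specnorm D * G / c) ^+ 2).
Proof.
set B0 := favg (weighted_avg pi X0) - fstar + kappa * consensus_error Winf X0.
apply: (@le_trans _ _ (Ex P (fun w => B0 + \sum_(0 <= t < T) r t w))).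
  rewrite -Ex_sum; last exact: integ_grad_favg.
  rewrite -ExZ; last by apply: integ_sum; exact: integ_grad_favg.
  apply: Ex_le => [||w]; last exact: pathwise_sum.
  - by apply: integZ; apply: integ_sum; exact: integ_grad_favg.
  - by apply: integD; [exact: integ_cst|exact: integ_sum].
rewrite ExD; [|exact: integ_cst|exact: integ_sum].
rewrite Ex_cst Ex_sum//; apply: lerD.
  rewrite /B0 lerD2l /kappa le_eqVlt; apply/orP; left; apply/eqP.
  by field; rewrite !gt_eqF.
rewrite mulr_natl -[X in _ *+ X](subn0 T) -sumr_const_nat.
apply: ler_sum => t _; apply: (le_trans (Ex_r t)); apply: lerD.
  by rewrite -mulr_suml (mulrA N%:R^-1).
(* The factor [N] from summing [G ^+ 2] over the nodes cancels the [1 / N] in [b2]. *)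
rewrite /b2 le_eqVlt; apply/orP; left; apply/eqP.
by field; rewrite !gt_eqF.
Qed.

End ExpectedDescent.
Theorem mainTheorem1 (R : realType) :
  exists K : R, 0 < K /\
  forall (N d : nat) (e : rel 'I_N) (W0 : 'M[R]_N) (k : 'I_N -> 'I_N -> nat)
    (Winf : 'M[R]_(ext_size e k)) (pi : 'rV[R]_(ext_size e k))
    (C rho : R) (tau : nat)
    (f : 'I_N -> 'rV[R]_d -> R) (fstar L G : R) (sigma : 'I_N -> R)
    (dO dS : measure_display) (Omega : measurableType dO)
    (P : probability Omega R) (S : 'I_N -> measurableType dS)
    (xi : forall (t : nat) (n : 'I_N), Omega -> S n)
    (gF : forall n : 'I_N, 'rV[R]_d -> S n -> 'rV[R]_d)
    (X0 : 'M[R]_(ext_size e k, d)),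
  let W := ext_matrix e k W0 in
  let D := correction pi in
  let c : R := 1 - C * rho ^+ tau in
  let favg : 'rV[R]_d -> R := fun x => N%:R^-1 * \sum_n f n x in
  let sigma2 : R := N%:R^-1 * \sum_n sigma n ^+ 2 in
  let F0 : R := favg (weighted_avg pi X0) - fstar in
  (0 < N)%N ->
  gossip_graph e ->
  gossip_matrix e W0 ->
  (fun t : nat => W ^+ t) @ \oo --> Winf ->
  (forall i j, Winf i j = pi 0 j) ->
  rho < 1 ->
  (forall t : nat, (0 < t)%N -> specnorm (W ^+ t - Winf) ^+ 2 <= C * rho ^+ t) ->
  specnorm (W ^+ tau - Winf) ^+ 2 <= C * rho ^+ tau ->
  C * rho ^+ tau < 1 ->
  0 <= L ->
  0 <= G ->
  (forall n, smooth L (f n)) ->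
  (forall x, fstar <= favg x) ->
  (forall n, jointly_measurable (gF n)) ->
  mutually_independent P (S := fun i : nat * 'I_N => S i.2)
    (fun i => xi i.1 i.2) ->
  (forall t n x j,
     'E_P[(fun w => gF n x (xi t n w) 0 j)%R] = (grad (f n) x 0 j)%R%:E)%E ->
  (forall t n x,
     'E_P[(fun w => l2norm (gF n x (xi t n w) - grad (f n) x) ^+ 2)%R]
       <= (sigma n ^+ 2)%R%:E)%E ->
  (forall t n x,
     'E_P[(fun w => l2norm (gF n x (xi t n w)) ^+ 2)%R] <= (G ^+ 2)%R%:E)%E ->
  exists T0 : nat,
    (0 < T0)%N /\
    ((forall i j, row i X0 = row j X0) -> T0 = 1%N) /\
    forall T : nat, (T0 <= T)%N ->
    exists eta : R,
      0 <= eta /\ (0 < F0 -> 0 < eta) /\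
      let X := fun (t : nat) (w : Omega) =>
        dtgo gF W D tau eta X0 (fun s n => xi s n w) t in
      ((T%:R^-1)%R%:E *
         \sum_(0 <= t < T)
           'E_P[(fun w => l2norm (grad favg (weighted_avg pi (X t w))) ^+ 2)%R]
       <= (K * ((L * F0 * sigma2 / (N%:R * T%:R)) `^ (1 / 2)
                + (specnorm D * G * L * F0 / (c * T%:R)) `^ (2 / 3)
                + L * F0 / T%:R))%R%:E)%E.
Proof.
exists 7; split=> // N d e W0 k Winf pi C rho tau f fstar L G sigma dO dS Omega P S xi gF X0.
move=> W D c favg sigma2 F0 N0 eG eW Wcvg Wpi rho1 _ Wq q1 L0 G0 fL fstar_le mgF
  xi_indep unbiased variance second_moment.
have F0_ge0 : 0 <= F0 by rewrite subr_ge0.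
have c0 : 0 < c by rewrite subr_gt0.
have NR : 0 < N%:R :> R by rewrite ltr0n.
have D0 : 0 < specnorm D by exact: (specnorm_correction_gt0 eW Wcvg Wpi N0 eG).
have s20 : 0 <= sigma2.
  by rewrite mulr_ge0 ?invr_ge0// sumr_ge0// => n _; rewrite sqr_ge0.
have grad_bound x : l2norm (grad favg x) ^+ 2 <= 2 * L * (favg x - fstar).
  by apply: descent_grad_bound => // y v; exact: avg_descent.
have grad_eq0 x : l2norm (grad favg x) ^+ 2 <= 0 -> l2norm (grad favg x) ^+ 2 = 0.
  by move=> g0; apply/eqP; rewrite eq_le g0 sqr_ge0.
pose X eta t w := iterate W pi tau eta xi gF X0 t w.
pose gradE eta t := Ex P (fun w => l2norm (grad favg (weighted_avg pi (X eta t w))) ^+ 2).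
have lhsE eta T : ((T%:R^-1)%R%:E * \sum_(0 <= t < T)
    'E_P[(fun w => l2norm (grad favg (weighted_avg pi (X eta t w))) ^+ 2)%R])%E =
    (T%:R^-1 * \sum_(0 <= t < T) gradE eta t)%:E.
  rewrite EFinM -sumEFin; congr (_ * _)%E; apply: eq_bigr => t _; rewrite unlock Ex_EFin//.
  exact: (integ_grad_favg W0 pi tau eta X0 fL mgF xi_indep unbiased variance second_moment).
pose rhs T := (L * F0 * sigma2 / (N%:R * T%:R)) `^ (1 / 2)
                + (specnorm D * G * L * F0 / (c * T%:R)) `^ (2 / 3)
                + L * F0 / T%:R.
have rhs_ge0 T : 0 <= rhs T by rewrite !addr_ge0 ?powR_ge0// divr_ge0// mulr_ge0.
suff main : exists T0 : nat, (0 < T0)%N /\ ((forall i j, row i X0 = row j X0) -> T0 = 1%N) /\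
    forall T : nat, (T0 <= T)%N -> exists eta : R, 0 <= eta /\ (0 < F0 -> 0 < eta) /\
      T%:R^-1 * \sum_(0 <= t < T) gradE eta t <= 7 * rhs T.
  have [T0 [T00 [T01 H]]] := main; exists T0; split=> //; split=> // T /H[eta [e0 [eF HT]]].
  exists eta; split=> //; split=> //; rewrite -lee_fin -lhsE in HT; exact: HT.
(* When the gradient vanishes along the whole trajectory the left-hand side is 0, and [T0 = 1] works
   with any admissible stepsize. *)
have degenerate eta : 0 <= eta -> (0 < F0 -> 0 < eta) ->
    (forall t w, l2norm (grad favg (weighted_avg pi (X eta t w))) ^+ 2 = 0) ->
    exists T0 : nat, (0 < T0)%N /\ ((forall i j, row i X0 = row j X0) -> T0 = 1%N) /\
    forall T : nat, (T0 <= T)%N -> exists eta : R, 0 <= eta /\ (0 < F0 -> 0 < eta) /\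
      T%:R^-1 * \sum_(0 <= t < T) gradE eta t <= 7 * rhs T.
  move=> eta0 eF g0; exists 1%N; split=> //; split=> // T _; exists eta; split=> //; split=> //.
  rewrite big1 ?mulr0 ?mulr_ge0// => t _; rewrite /gradE -[RHS](Ex_cst P 0).
  by congr Ex; apply/funext => w; exact: g0.
have [F00|F0n0] := eqVneq F0 0.
  apply: (degenerate 0) => // [|t w]; first by rewrite F00 ltxx.
  have -> : weighted_avg pi (X 0 t w) = weighted_avg pi X0.
    elim: t => [//|t IHt]; rewrite /X /iterate /=.
    rewrite (step_avg tau N0 eG eW Wcvg Wpi); last exact: virtual_stoch_grads.
    by rewrite scale0r subr0.
  by apply: grad_eq0; rewrite (le_trans (grad_bound _))// -/F0 F00 mulr0.
have F0p : 0 < F0 by rewrite lt0r F0n0.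
have [L00|Ln0] := eqVneq L 0.
  apply: (degenerate 1) => // t w.
  by apply: grad_eq0; rewrite (le_trans (grad_bound _))// L00 mulr0 mul0r.
have Lp : 0 < L by rewrite lt0r Ln0.
have [G00|Gn0] := eqVneq G 0.
  apply: (degenerate 1) => // t w.
  rewrite (grad_avg fL) big1 ?scaler0 ?l2norm0 ?expr0n// => n _.
  apply/eqP; rewrite -l2norm_eq0 -sqrf_eq0 eq_le sqr_ge0 andbT.
  have := l2norm_grad_le mgF xi_indep unbiased variance second_moment n (weighted_avg pi (X 1 t w)).
  by rewrite G00 expr0n.
have Gp : 0 < G by rewrite lt0r Gn0.
pose e0 := consensus_error Winf X0.
have e0_ge0 : 0 <= e0 by rewrite /e0 /consensus_error sqr_ge0.
(* [a] is the contribution of the initial disagreement as it appears in [expected_gradient_sum]. *)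
pose a := 2 * L ^+ 2 * e0 / (N%:R * c).
have a0 : 0 <= a.
  by apply: divr_ge0; [rewrite mulr_ge0// mulr_ge0// sqr_ge0|rewrite mulr_ge0// ltW].
pose M := specnorm D * G * L * F0 / c.
have M0 : 0 < M by rewrite /M divr_gt0// !mulr_gt0.
(* The successor of the integer part exceeds [a ^+ 3 / M ^+ 2], the threshold of [transient_le].
   With identical initial rows [a = 0], and this number is 1. *)
exists (Num.truncn (a ^+ 3 / M ^+ 2)).+1; split=> //; split.
  move=> rowsE; rewrite /a /e0 (consensus_error_eq_rows N0 eW Wcvg Wpi rowsE).
  by rewrite mulr0 mul0r expr0n mul0r truncn0.
move=> T T0T.
have Tgt : a ^+ 3 / M ^+ 2 <= T%:R.
  by apply: (le_trans (ltW (truncnS_gt _))); rewrite ler_nat.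
have Tp : 0 < T%:R :> R by rewrite ltr0n (leq_trans _ T0T).
pose s := (L * F0 * sigma2 / (N%:R * T%:R)) `^ (1 / 2).
pose x := specnorm D * G * L * F0 / (c * T%:R).
have xE : x = M / T%:R by rewrite /x /M invfM mulrA.
have x0 : 0 < x by rewrite xE divr_gt0.
pose u := x `^ (1 / 3); pose v := L * F0 / T%:R.
have u0 : 0 < u by rewrite powR_gt0.
have u3 : u ^+ 3 = M / T%:R by rewrite /u powR_third_cube ?xE// -xE ltW.
pose B2 := L * specnorm D * G / c.
pose eta := F0 / (T%:R * (s + u ^+ 2 + v)).
have [] := @stepsize_bound R F0 L (sigma2 / N%:R) B2 a T%:R s u v
  (\sum_(0 <= t < T) gradE eta t) (s + u ^+ 2 + v) eta => //.
- exact: powR_ge0.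
- by rewrite divr_ge0.
- rewrite /s powR_half_sqr; first by field; rewrite !gt_eqF.
  by apply: divr_ge0; [apply: mulr_ge0 => //; exact: mulr_ge0|exact: mulr_ge0].
- have -> : u ^+ 6 = (u ^+ 3) ^+ 2 by ring.
  by rewrite u3 /M /B2; congr (_ ^+ 2); field; rewrite !gt_eqF.
- exact: transient_le u3 Tgt.
move=> eta0 etaL H; exists eta; split; first exact: ltW; split=> //.
rewrite /rhs -powR_third_sqr; apply: H.
exact: (expected_gradient_sum X0 N0 eG eW Wcvg Wpi Wq q1 L0 fL fstar_le mgF xi_indep unbiased
  variance second_moment (ltW eta0) etaL).
Qed.
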